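(* Let $Y \in V^n$ be a tuple of complex samples, and let $G \subseteq \mathrm{GL}_{\mathbb{C}}(V)$ be a Zariski closed self-adjoint group which is closed under non-zero complex scalar multiples. The stability of $Y$ under the action of $G_{\mathrm{SL}}^{+}$ on $V^n$ is related to maximum likelihood estimation for the complex Gaussian group model $\mathcal{M}_G$ as follows: (a) $Y$ is unstable if and only if $\ell_Y$ is not bounded from above on $\mathcal{M}_G$; (b) $Y$ is semistable if and only if $\ell_Y$ is bounded from above on $\mathcal{M}_G$; (c) $Y$ is polystable if and only if an MLE given $Y$ exists; (d) $Y$ is stable if and only if finitely many MLEs given $Y$ exist (i.e. the set of MLEs is non-empty and finite), if and only if a unique MLE given $Y$ exists.
   Context: $V$ is a finite-dimensional complex vector space, identified with $\mathbb{C}^m$, $m=\dim_{\mathbb{C}} V$, by a fixed isomorphism, so that elements of $\mathrm{GL}_{\mathbb{C}}(V)$ are invertible complex $m\times m$ matrices. $g^*$ denotes the Hermitian (conjugate) transpose. A subgroup $G\subseteq \mathrm{GL}_{\mathbb{C}}(V)$ is closed under non-zero complex scalar multiples if $cg\in G$ for all $g \in G$, $c\in\mathbb{C}\setminus\{0\}$; Zariski closed if it is the zero locus (in $\mathrm{GL}_{\mathbb{C}}(V)$) of a set of polynomials in the matrix entries; self-adjoint if $g\in G$ implies $g^{*}\in G$. $G_{\mathrm{SL}}^{+}$ is the subgroup of all matrices in $G$ with determinant one. The complex Gaussian group model given by $G$ is the set of concentration matrices $\mathcal{M}_G=\{g^{*}g \mid g\in G\}$. For $Y=(Y_1,\dots,Y_n)\in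 V^n$, the log-likelihood is $\ell_Y(\Psi)=\log\det(\Psi)-\mathrm{tr}(\Psi S_Y)$ for $\Psi\in\mathcal{M}_G$, where $S_Y=\frac1n\sum_{i=1}^n Y_iY_i^{*}$. An MLE given $Y$ is a matrix in $\mathcal{M}_G$ at which $\ell_Y$ attains its maximum over $\mathcal{M}_G$. The group $G$ acts on $V^n$ by $g\cdot Y=(gY_1,\dots,gY_n)$. Stability notions for a group $H$ acting linearly on a real or complex vector space $W$ and $v\in W$ (closures in the Euclidean topology): $v$ is unstable if $0\in\overline{H\cdot v}$; semistable if $0\notin\overline{H\cdot v}$; polystable if $v\neq0$ and the orbit $H\cdot v$ is closed; stable if $v$ is polystable and its stabilizer in $H$ is finite. *)

(* Defs.v *)
From HB Require Import structures.
From mathcomp Require Import all_boot all_order all_algebra.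
From mathcomp Require Import all_classical all_reals all_analysis.
From mathcomp Require Import complex.
(* Not imported: the notations of mpoly clash with those of analysis. *)
From mathcomp Require mpoly.

Set Implicit Arguments.
Unset Strict Implicit.
Unset Printing Implicit Defensive.

Import Order.TTheory GRing.Theory Num.Theory.
Import numFieldNormedType.Exports.

Local Open Scope classical_set_scope.
Local Open Scope ring_scope.
Local Open Scope sesquilinear_scope.

(* A tuple Y = (Y_1, ..., Y_n) of vectors of C^m is encoded as the m x n matrix
   whose i-th column is Y_i.  With this encoding g . Y = (g Y_1, ..., g Y_n) is
   the matrix product g *m Y, and the topology on matrices is the product of
   the topology given by the modulus on each entry. *)

Section Groups.
Context {C : numClosedFieldType} {m : nat}.
Implicit Types G : set 'M[C]_m.

Definition GL_subgroup G : Prop :=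
  [/\ G `<=` [set g | g \in unitmx],
      G 1%:M,
      (forall g h, G g -> G h -> G (g *m h)) &
      (forall g, G g -> G (invmx g))].

(* Variables of polynomials are the matrix entries, in the order of mxvec. *)
Definition eval_entries (p : mpoly.mpoly (m * m) C) (g : 'M[C]_m) : C :=
  mpoly.meval (fun k => mxvec g 0 k) p.

Definition Zariski_closed G : Prop :=
  exists S : set (mpoly.mpoly (m * m) C),
    G = [set g | g \in unitmx /\ forall p, S p -> eval_entries p g = 0].

Definition self_adjoint G : Prop := forall g, G g -> G (g ^t*).

Definition scaling_closed G : Prop :=
  forall (c : C) g, c != 0 -> G g -> G (c *: g).

Definition SL_part G : set 'M[C]_m := [set g | G g /\ \det g = 1].

End Groups.

Section Stability.
Context {C : numClosedFieldType} {m n : nat}.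
Implicit Types (H : set 'M[C]_m) (Y : 'M[C]_(m, n)).

Definition orbit H Y : set 'M[C]_(m, n) := [set g *m Y | g in H].

Definition stabilizer H Y : set 'M[C]_m := [set g | H g /\ g *m Y = Y].

Definition unstable H Y : Prop := closure (orbit H Y) 0.

Definition semistable H Y : Prop := ~ closure (orbit H Y) 0.

Definition polystable H Y : Prop := Y <> 0 /\ closed (orbit H Y).

Definition stable H Y : Prop := polystable H Y /\ finite_set (stabilizer H Y).

End Stability.

Section GaussianGroupModel.
Context {R : realType} {m n : nat}.
Implicit Types (G : set 'M[R[i]]_m) (Y : 'M[R[i]]_(m, n)) (Psi : 'M[R[i]]_m).

Definition gaussian_model G : set 'M[R[i]]_m := [set g ^t* *m g | g in G].

Definition sample_cov Y : 'M[R[i]]_m :=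
  n%:R^-1 *: \sum_(i < n) col i Y *m (col i Y) ^t*.

(* For Psi = g^* g with g invertible, det Psi is a positive real and
   tr (Psi S_Y) is real, so taking real parts loses nothing. *)
Definition loglik Y Psi : R :=
  ln (complex.Re (\det Psi)) - complex.Re (\tr (Psi *m sample_cov Y)).

Definition loglik_bounded_above G Y : Prop :=
  has_ubound [set loglik Y Psi | Psi in gaussian_model G].

Definition MLE G Y : set 'M[R[i]]_m :=
  [set Psi | gaussian_model G Psi /\
    forall Psi', gaussian_model G Psi' -> loglik Y Psi' <= loglik Y Psi].

End GaussianGroupModel.

(* Main.v *)
(* Every g in G is a scalar multiple of some h in H = SL_part G, so M_G consists of
   the t h^* h with t > 0, where the log-likelihood is m ln t - t |hY|^2 / n.
   Maximizing in t reduces everything to minimizing |hY| over h in H, and the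
   theorem becomes the Kempf-Ness theorem for H.

   If h in H and h^* h = U^* diag(e^b) U, then U^* diag(e^(tb)) U is in H for all
   real t, H being Zariski closed; hence if Z = hY has minimal norm, then
   sum_j b_j |(UZ)_j|^2 = 0, and |hZ| = |Z| forces h^* h Z = Z. To see that the
   orbit of a minimal Z is closed, approach a point of its closure by h Z with h
   of least Frobenius norm in h Stab(Z). Such h stay bounded, since otherwise the
   limit of b / |b| yields a one-parameter subgroup of Stab(Z) along which h can be
   shortened.

   Uniqueness of the MLE means that Stab(Z) consists of unitary matrices. A Zariski
   closed group of unitary matrices is finite: otherwise it contains matrices
   U^* diag(e^(i theta)) U with theta arbitrarily small and nonzero, and passing
   from i theta to theta / |theta| produces in the limit a non-unitary element. *)

Require Import Defs.
From HB Require Import structures.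
From mathcomp Require Import all_boot all_order all_algebra.
From mathcomp Require Import all_classical all_reals all_analysis.
From mathcomp Require Import complex.
From mathcomp Require Import ring lra.
From mathcomp Require mpoly.
Import Order.TTheory GRing.Theory Num.Theory.
Import numFieldNormedType.Exports.

Local Open Scope classical_set_scope.
Local Open Scope ring_scope.

Set Implicit Arguments.
Unset Strict Implicit.
Unset Printing Implicit Defensive.

Local Open Scope sesquilinear_scope.

(** * Polynomial functions on matrices *)

Section PolynomialFunctions.
Context {K : fieldType}.

(** Newton interpolation with possibly repeated nodes: a new node is reached by adding a multiple of
    the polynomial that vanishes at the earlier ones. *)
Lemma polynomial_interpolation (I : eqType) (s : seq I) (x y : I -> K) :
    {in s &, forall i j, x i = x j -> y i = y j} ->
  exists q : {poly K}, {in s, forall i, q.[x i] = y i}.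
Proof.
elim: s => [|i s IH] xy; first by exists 0.
have [|q qP] := IH.
  by move=> j k js ks; apply: xy; rewrite inE ?js ?ks orbT.
have [|xis] := boolP (x i \in map x s).
  case/mapP=> j js xij; exists q => k; rewrite inE => /predU1P[->|/qP//].
  by rewrite xij qP //; apply: xy; rewrite ?inE ?eqxx ?js ?orbT.
pose r : {poly K} := \prod_(z <- map x s) ('X - z%:P).
have ri0 : r.[x i] != 0 by rewrite -/(root r _) root_prod_XsubC.
exists (q + ((y i - q.[x i]) / r.[x i]) *: r) => j.
rewrite inE hornerD hornerZ => /predU1P[->|js]; first by rewrite divfK// subrKC.
rewrite qP // [r.[x j]](_ : _ = 0) ?mulr0 ?addr0//.
by apply/eqP; rewrite -/(root r _) root_prod_XsubC map_f.
Qed.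

(** By interpolation [y] is a polynomial in [x], so the sum is a linear combination of the vanishing
    power sums. This replaces a Vandermonde argument and allows coinciding [x i]. *)
Lemma power_sums_eq0 (I : finType) (c x y : I -> K) :
    (forall k, \sum_i c i * x i ^+ k = 0) ->
    (forall i j, x i = x j -> y i = y j) ->
  \sum_i c i * y i = 0.
Proof.
move=> cx xy; have [|q qP] := @polynomial_interpolation I (enum I) x y.
  by move=> i j _ _; apply: xy.
transitivity (\sum_(k < size q) q`_k * (\sum_i c i * x i ^+ k)); last first.
  by apply: big1 => k _; rewrite cx mulr0.
under [RHS]eq_bigr do rewrite mulr_sumr.
rewrite exchange_big; apply: eq_bigr => i _.
rewrite -qP ?mem_enum// horner_coef mulr_sumr; apply: eq_bigr => k _; ring.
Qed.

(** Given by closure rules, so that diagonal restrictions and limits are treated by induction. *)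
Inductive polyfun {m : nat} : ('M[K]_m -> K) -> Prop :=
| polyfun_cst c : polyfun (fun=> c)
| polyfun_entry i j : polyfun (fun g => g i j)
| polyfun_add f h : polyfun f -> polyfun h -> polyfun (fun g => f g + h g)
| polyfun_mul f h : polyfun f -> polyfun h -> polyfun (fun g => f g * h g).

Lemma polyfun_sum m (I : Type) (r : seq I) (P : pred I) (F : I -> 'M[K]_m -> K) :
  (forall i, polyfun (F i)) -> polyfun (fun g => \sum_(i <- r | P i) F i g).
Proof.
move=> pF; elim: r => [|i r IH].
  by under eq_fun do rewrite big_nil; exact: polyfun_cst.
under eq_fun do rewrite big_cons; case: (P i) => //.
exact: polyfun_add.
Qed.

Lemma polyfun_prod m (I : Type) (r : seq I) (P : pred I) (F : I -> 'M[K]_m -> K) :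
  (forall i, polyfun (F i)) -> polyfun (fun g => \prod_(i <- r | P i) F i g).
Proof.
move=> pF; elim: r => [|i r IH].
  by under eq_fun do rewrite big_nil; exact: polyfun_cst.
under eq_fun do rewrite big_cons; case: (P i) => //.
exact: polyfun_mul.
Qed.

Lemma polyfun_exp m (f : 'M[K]_m -> K) k :
  polyfun f -> polyfun (fun g => f g ^+ k).
Proof.
move=> pf; elim: k => [|k IH]; first by under eq_fun do rewrite expr0; exact: polyfun_cst.
under eq_fun do rewrite exprS; exact: polyfun_mul.
Qed.

Lemma polyfun_det m : polyfun (fun g : 'M[K]_m => \det g).
Proof.
apply: polyfun_sum => s; apply: polyfun_mul; first exact: polyfun_cst.
by apply: polyfun_prod => i; exact: polyfun_entry.
Qed.

Lemma polyfun_mulmx m n (Y : 'M[K]_(m, n)) i j :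
  polyfun (fun g : 'M[K]_m => (g *m Y) i j).
Proof.
under eq_fun do rewrite mxE.
apply: polyfun_sum => k; apply: polyfun_mul; first exact: polyfun_entry.
exact: polyfun_cst.
Qed.

Definition monomial {m} (w : 'I_m -> K) (mu : 'I_m -> nat) : K :=
  \prod_j w j ^+ mu j.

(* The exponents [mu] must not depend on the basis: they are used for a
   converging family of unitary matrices [V = U^t*]. *)
Lemma polyfun_diag m (f : 'M[K]_m -> K) : polyfun f ->
  exists (I : finType) (mu : I -> 'I_m -> nat), forall U V : 'M[K]_m,
  exists c : I -> K, forall w,
    f (U *m diag_mx (\row_j w j) *m V) = \sum_i c i * monomial w (mu i).
Proof.
elim=> {f} [c|i j|f h _ [I [mu fE]] _ [J [nu hE]]|f h _ [I [mu fE]] _ [J [nu hE]]].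
- exists unit, (fun _ _ => 0%N) => U V; exists (fun=> c) => w.
  by rewrite (big_pred1 tt) /monomial ?big1 ?mulr1 //; case.
- exists 'I_m, (fun k l => (k == l)%N) => U V.
  exists (fun k => U i k * V k j) => w.
  rewrite mxE; apply: eq_bigr => k _; rewrite /monomial (bigD1 k)//= eqxx expr1.
  rewrite big1 ?mulr1 => [|l /negPf]; last by rewrite eq_sym => ->; rewrite expr0.
  by rewrite mul_mx_diag !mxE; ring.
- exists (I + J)%type,
    (fun s => match s with inl i => mu i | inr j => nu j end) => U V.
  have [[c {}fE] [d {}hE]] := (fE U V, hE U V).
  exists (fun s => match s with inl i => c i | inr j => d j end) => w.
  by rewrite big_sumType/= fE hE.
- exists (I * J)%type, (fun s k => (mu s.1 k + nu s.2 k)%N) => U V.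
  have [[c {}fE] [d {}hE]] := (fE U V, hE U V).
  exists (fun s => c s.1 * d s.2) => w.
  rewrite fE hE big_distrlr pair_big/=; apply: eq_bigr => -[i j] _ /=.
  rewrite /monomial; under [in RHS]eq_bigr do rewrite exprD.
  by rewrite big_split/=; ring.
Qed.

Lemma monomialX m (w : 'I_m -> K) mu k :
  monomial (fun j => w j ^+ k) mu = monomial w mu ^+ k.
Proof. by rewrite /monomial -prodrXl; apply: eq_bigr => j _; rewrite exprAC. Qed.

(** Zeros are taken among all matrices, not only the invertible ones, so that an algebraic set is
    closed in the whole matrix space. *)
Definition algebraic {m} (X : set 'M[K]_m) :=
  exists2 S : set ('M[K]_m -> K), (forall f, S f -> polyfun f) &
    X = [set g | forall f, S f -> f g = 0].

Lemma algebraicI m (X Y : set 'M[K]_m) :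
  algebraic X -> algebraic Y -> algebraic (X `&` Y).
Proof.
move=> [S pS ->] [T pT ->]; exists (S `|` T) => [f [/pS|/pT]//|].
apply/seteqP; split => [g [gS gT] f [/gS|/gT]//|g gST].
by split=> f ?; apply: gST; [left|right].
Qed.

Lemma algebraic_det1 m : algebraic [set g : 'M[K]_m | \det g = 1].
Proof.
exists [set (fun g => \det g + -1)].
  by move=> _ ->; apply: polyfun_add; [exact: polyfun_det|exact: polyfun_cst].
apply/seteqP; split => g /=; first by move=> g1 _ ->; rewrite g1 subrr.
by move/(_ _ erefl)/eqP; rewrite subr_eq0 => /eqP.
Qed.

Lemma algebraic_mulmx_eq m n (Y W : 'M[K]_(m, n)) : algebraic [set g | g *m Y = W].
Proof.
exists (range (fun ij g => (g *m Y) ij.1 ij.2 + - W ij.1 ij.2)).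
  move=> _ [[i j] _ <-]; apply: polyfun_add; last exact: polyfun_cst.
  exact: polyfun_mulmx.
apply/seteqP; split => g /= gY; first by move=> _ [[i j] _ <-]; rewrite gY subrr.
apply/matrixP => i j; apply/eqP; rewrite -subr_eq0; apply/eqP.
by apply: (gY (fun g => (g *m Y) i j + - W i j)); exists (i, j).
Qed.

End PolynomialFunctions.

Lemma polyfun_eval_entries (C : numClosedFieldType) m (p : mpoly.mpoly (m * m) C) :
  polyfun (eval_entries p : 'M[C]_m -> C).
Proof.
rewrite /eval_entries; under eq_fun do rewrite mpoly.mevalE.
apply: polyfun_sum => mu; apply: polyfun_mul; first exact: polyfun_cst.
apply: polyfun_prod => k; apply: polyfun_exp.
case/mxvec_indexP: k => i j; under eq_fun do rewrite mxvecE; exact: polyfun_entry.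
Qed.

(** The equation [\det g = 1] already forces invertibility, so the zero locus in GL becomes a zero
    locus among all matrices. *)
Lemma algebraic_SL_part (C : numClosedFieldType) m (G : set 'M[C]_m) :
  Zariski_closed G -> algebraic (SL_part G).
Proof.
move=> [S ->].
rewrite (_ : SL_part _ = [set g | forall f, [set eval_entries p | p in S] f -> f g = 0]
   `&` [set g : 'M[C]_m | \det g = 1]).
  apply: algebraicI; last exact: algebraic_det1.
  by exists [set eval_entries p | p in S] => // _ [p _ <-]; exact: polyfun_eval_entries.
apply/seteqP; split => g [].
  by move=> [_ gS] g1; split=> // _ [p Sp <-]; exact: gS.
move=> gS /= g1; split=> //; split; first by rewrite /= unitmxE g1 unitr1.
by move=> p Sp; apply: gS; exists p.
Qed.

(** * Unitarily diagonalizable matrices *)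

Section UnitaryDiagonal.
Context {C : numClosedFieldType}.

Lemma adjM p q r (A : 'M[C]_(p, q)) (B : 'M[C]_(q, r)) :
  (A *m B)^t* = B^t* *m A^t*.
Proof. by rewrite trmx_mul map_mxM. Qed.

Lemma adjZ p q (c : C) (A : 'M[C]_(p, q)) : (c *: A)^t* = Num.conj c *: A^t*.
Proof. by apply/matrixP => i j; rewrite !mxE rmorphM. Qed.

Lemma unitarymx_adjl p (U : 'M[C]_p) : U \is unitarymx -> U^t* *m U = 1%:M.
Proof. by move=> /unitarymxP/mulmx1C. Qed.

(** The squared Frobenius norm, with values in [C]. *)
Definition trn p q (X : 'M[C]_(p, q)) : C := \tr (X *m X^t*).

Lemma trnE p q (X : 'M[C]_(p, q)) :
  trn X = \sum_i \sum_j X i j * Num.conj (X i j).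
Proof.
apply: eq_bigr => i _; rewrite mxE; apply: eq_bigr => j _.
by rewrite !mxE.
Qed.

Lemma trn_adj p q (X : 'M[C]_(p, q)) : trn (X^t*) = trn X.
Proof. by rewrite /trn trmxCK mxtrace_mulC. Qed.

Lemma trn_unitaryr p q (U : 'M[C]_q) (X : 'M[C]_(p, q)) : U \is unitarymx ->
  trn (X *m U) = trn X.
Proof.
by move=> /unitarymxP Uu; rewrite /trn adjM mulmxA -(mulmxA _ U) Uu mulmx1.
Qed.

Lemma trn_unitaryl p q (U : 'M[C]_p) (X : 'M[C]_(p, q)) : U \is unitarymx ->
  trn (U *m X) = trn X.
Proof.
move=> Uu; rewrite -[LHS]trn_adj adjM trn_unitaryr ?trn_adj//.
by rewrite trmxC_unitary.
Qed.

Lemma trnZ p q (c : C) (X : 'M[C]_(p, q)) : trn (c *: X) = c * Num.conj c * trn X.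
Proof. by rewrite /trn adjZ -scalemxAl -scalemxAr scalerA linearZ. Qed.

(** For unitary [U] this is a general normal matrix with eigenvalues [d]; positive definite and
    unitary matrices are both handled in this form. *)
Definition hdiag m (U : 'M[C]_m) (d : 'rV[C]_m) : 'M[C]_m :=
  U^t* *m diag_mx d *m U.

Lemma hdiagM m (U : 'M[C]_m) (d d' : 'rV[C]_m) : U \is unitarymx ->
  hdiag U d *m hdiag U d' = hdiag U (\row_j (d 0 j * d' 0 j)).
Proof.
move=> /unitarymxP Uu; rewrite /hdiag -mulmx_diag -!mulmxA.
by rewrite (mulmxA U) Uu mul1mx.
Qed.

Lemma adj_hdiag m (U : 'M[C]_m) (d : 'rV[C]_m) :
  (hdiag U d)^t* = hdiag U (\row_j Num.conj (d 0 j)).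
Proof.
rewrite /hdiag !adjM trmxCK -mulmxA; congr (_ *m (_ *m _)).
apply/matrixP => i j; rewrite !mxE eq_sym; case: eqP => [->|_].
  by rewrite !mulr1n.
by rewrite !mulr0n conjC0.
Qed.

Lemma hdiag1 m (U : 'M[C]_m) : U \is unitarymx -> hdiag U (const_mx 1) = 1%:M.
Proof. by move=> /unitarymx_adjl Uu; rewrite /hdiag diag_const_mx mulmx1. Qed.

Lemma det_unitary_adj m (U : 'M[C]_m) : U \is unitarymx -> \det (U^t*) * \det U = 1.
Proof. by move=> /unitarymx_adjl Uu; rewrite -det_mulmx Uu det1. Qed.

Lemma det_hdiag m (U : 'M[C]_m) (d : 'rV[C]_m) : U \is unitarymx ->
  \det (hdiag U d) = \prod_j d 0 j.
Proof.
by move=> Uu; rewrite /hdiag !det_mulmx mulrAC det_unitary_adj// mul1r det_diag.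
Qed.

Lemma hdiag_diag m (U : 'M[C]_m) (d : 'rV[C]_m) j : U \is unitarymx ->
  (U *m hdiag U d *m U^t*) j j = d 0 j.
Proof.
move=> /unitarymxP Uu; rewrite /hdiag !mulmxA Uu mul1mx -mulmxA Uu mulmx1.
by rewrite mxE eqxx mulr1n.
Qed.

Lemma trn_mul_hdiag m n (h U : 'M[C]_m) (d : 'rV[C]_m) (X : 'M[C]_(m, n)) :
  h^t* *m h = hdiag U d ->
  trn (h *m X) = \sum_j d 0 j * trn (row j (U *m X)).
Proof.
move=> hU; rewrite /trn mxtrace_mulC adjM mulmxA -(mulmxA _ _ h) hU.
have -> : X^t* *m hdiag U d *m X = (U *m X)^t* *m (diag_mx d *m (U *m X)).
  by rewrite adjM /hdiag !mulmxA.
rewrite mxtrace_mulC mul_diag_mx; apply: eq_bigr => j _.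
rewrite /mxtrace big_ord1 !mxE mulr_sumr; apply: eq_bigr => k _.
by rewrite !mxE mulrA.
Qed.

Lemma hdiag_fix m n (U : 'M[C]_m) (d : 'rV[C]_m) (X : 'M[C]_(m, n)) :
    U \is unitarymx -> (forall j, d 0 j = 1 \/ row j (U *m X) = 0) ->
  hdiag U d *m X = X.
Proof.
move=> Uu dX; rewrite /hdiag -mulmxA -mulmxA.
rewrite (_ : diag_mx _ *m (U *m X) = U *m X).
  by rewrite mulmxA unitarymx_adjl // mul1mx.
apply/matrixP => j k; rewrite mul_diag_mx !mxE.
case: (dX j) => [->|/rowP/(_ k)]; first by rewrite mul1r.
by rewrite !mxE => ->; rewrite mulr0.
Qed.

Lemma normalmx_hdiag m (p : 'M[C]_m) : p \is normalmx ->
  exists U d, U \is unitarymx /\ p = hdiag U d.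
Proof.
move=> /orthomx_spectralP pE; exists (spectralmx p), (spectral_diag p).
split; first exact: spectral_unitarymx.
by rewrite {1}pE invmx_unitary ?spectral_unitarymx.
Qed.

(** The eigenvalues are the diagonal entries of the Gram matrix of the rows of [U *m h^t*]; being
    squared norms, they are nonnegative. *)
Lemma gram_hdiag m (h : 'M[C]_m) : exists U d,
  [/\ U \is unitarymx, h^t* *m h = hdiag U d &
      forall j, d 0 j = trn (row j (U *m h^t*))].
Proof.
have /normalmx_hdiag[U [d [Uu pE]]] : h^t* *m h \is normalmx.
  by apply/normalmxP; rewrite adjM trmxCK.
exists U, d; split => // j; rewrite -(hdiag_diag d j Uu) -pE.
rewrite /trn /mxtrace big_ord1 !mulmxA -mulmxA.
rewrite -[X in _ *m X]trmxCK adjM trmxCK !mxE.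
by apply: eq_bigr => k _; rewrite !mxE.
Qed.

Lemma det_gram m (h : 'M[C]_m) : \det (h^t* *m h) = Num.conj (\det h) * \det h.
Proof. by rewrite det_mulmx det_map_mx det_tr. Qed.

End UnitaryDiagonal.

(* R[i] is sealed as an abstract numClosedFieldType, because comparing terms is
   prohibitively slow when it unfolds the structures of R[i]. This also gives
   R[i] the topology that analysis attaches to an abstract numFieldType. *)
Definition Cx (R : realType) : numClosedFieldType := R[i].

Definition toC {R : realType} (x : R) : Cx R := real_complex R x.

Fact toC_is_zmod_morphism (R : realType) : zmod_morphism (@toC R).
Proof. exact: (rmorphB (real_complex R)). Qed.

Fact toC_is_monoid_morphism (R : realType) : monoid_morphism (@toC R).
Proof. by split; [exact: rmorph1|exact: (rmorphM (real_complex R))]. Qed.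

HB.instance Definition _ (R : realType) :=
  GRing.isZmodMorphism.Build R (Cx R) toC (@toC_is_zmod_morphism R).
HB.instance Definition _ (R : realType) :=
  GRing.isMonoidMorphism.Build R (Cx R) toC (@toC_is_monoid_morphism R).

Section Cx.
Context {R : realType}.
Local Notation C := (Cx R).

Lemma toC_inj : injective (@toC R).
Proof. exact: complexI. Qed.

Lemma conj_toC (x : R) : Num.conj (toC x) = toC x.
Proof. exact: conjc_real. Qed.

Lemma ltr_toC (x y : R) : (toC x < toC y) = (x < y).
Proof. exact: ltcR. Qed.

Lemma ler_toC (x y : R) : (toC x <= toC y) = (x <= y).
Proof. exact: lecR. Qed.

Lemma toC_real (z : C) : z \is Num.real -> exists x, z = toC x.
Proof. by move=> /complex_realP. Qed.

Definition reC (z : C) : R := complex.Re z.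

Definition imC (z : C) : R := complex.Im z.

Definition iC : C := Complex 0 1.

Lemma Cx_rect (z : C) : z = toC (reC z) + iC * toC (imC z).
Proof. exact: complexE. Qed.

Lemma iC_sqr : iC * iC = -1.
Proof. by rewrite -expr2; exact: sqr_i. Qed.

Lemma reCD (x y : C) : reC (x + y) = reC x + reC y.
Proof. by case: x y => [? ?] [? ?]. Qed.

Lemma imCD (x y : C) : imC (x + y) = imC x + imC y.
Proof. by case: x y => [? ?] [? ?]. Qed.

Lemma reCB (x y : C) : reC (x - y) = reC x - reC y.
Proof. by case: x y => [? ?] [? ?]. Qed.

Lemma imCB (x y : C) : imC (x - y) = imC x - imC y.
Proof. by case: x y => [? ?] [? ?]. Qed.

Lemma reC1 : reC 1 = 1. Proof. by []. Qed.

Lemma imC1 : imC 1 = 0. Proof. by []. Qed.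

Lemma imC_rect (x y : R) : imC (toC x + iC * toC y) = y.
Proof. by rewrite /imC /toC /iC /= mul0r mul1r !add0r. Qed.

Definition nsq (z : C) : R := reC z ^+ 2 + imC z ^+ 2.

Lemma nsqE (z : C) : nsq z = reC z ^+ 2 + imC z ^+ 2.
Proof. by []. Qed.

Lemma toC_nsq (z : C) : toC (nsq z) = z * Num.conj z.
Proof. exact: etrans (add_Re2_Im2 _) (sqr_normc _). Qed.

Lemma nsq_ge0 (z : C) : 0 <= nsq z.
Proof. by rewrite addr_ge0 ?sqr_ge0. Qed.

Lemma le_Re_nsq (z : C) : reC z ^+ 2 <= nsq z.
Proof. by rewrite lerDl sqr_ge0. Qed.

Lemma le_Im_nsq (z : C) : imC z ^+ 2 <= nsq z.
Proof. by rewrite lerDr sqr_ge0. Qed.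

Lemma nsq_eq0 (z : C) : (nsq z == 0) = (z == 0).
Proof.
by rewrite -(inj_eq toC_inj) toC_nsq rmorph0 mulf_eq0 conjC_eq0 orbb.
Qed.

End Cx.

Opaque Cx toC nsq reC imC iC.

(** * Exponentials of Hermitian matrices and their real powers *)

Section HermitianExponentials.
Context {R : realType}.
Local Notation C := (Cx R).

(** The same squared norm as [trn], but real-valued, so that it can be minimized. *)
Definition sqn p q (X : 'M[C]_(p, q)) : R :=
  \sum_i \sum_j nsq (X i j).

Lemma sqnE p q (X : 'M[C]_(p, q)) : toC (sqn X) = trn X.
Proof.
rewrite trnE /sqn rmorph_sum; apply: eq_bigr => i _; rewrite rmorph_sum.
by apply: eq_bigr => j _; rewrite /= toC_nsq.
Qed.

Lemma sqn_ge0 p q (X : 'M[C]_(p, q)) : 0 <= sqn X.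
Proof. by do 2![apply: sumr_ge0 => ? _]; exact: nsq_ge0. Qed.

Lemma le_entry_sqn p q (X : 'M[C]_(p, q)) i j : nsq (X i j) <= sqn X.
Proof.
rewrite /sqn (bigD1 i)//= (bigD1 j)//= -addrA lerDl addr_ge0//.
  by apply: sumr_ge0 => ? _; exact: nsq_ge0.
by do 2![apply: sumr_ge0 => ? _]; exact: nsq_ge0.
Qed.

Lemma sqn_eq0 p q (X : 'M[C]_(p, q)) : (sqn X == 0) = (X == 0).
Proof.
apply/eqP/eqP => [X0|->]; last first.
  by do 2![apply: big1 => ? _]; rewrite mxE; apply/eqP; rewrite nsq_eq0.
apply/matrixP => i j; rewrite mxE; apply/eqP; rewrite -nsq_eq0.
by rewrite eq_le nsq_ge0 andbT -X0 le_entry_sqn.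
Qed.

Lemma sqn_gt0 p q (X : 'M[C]_(p, q)) : (0 < sqn X) = (X != 0).
Proof. by rewrite lt_def sqn_eq0 sqn_ge0 andbT. Qed.

Lemma sqn_unitaryl p q (U : 'M[C]_p) (X : 'M[C]_(p, q)) : U \is unitarymx ->
  sqn (U *m X) = sqn X.
Proof. by move=> Uu; apply: toC_inj; rewrite !sqnE trn_unitaryl. Qed.

Lemma sqn_unitaryr p q (U : 'M[C]_q) (X : 'M[C]_(p, q)) : U \is unitarymx ->
  sqn (X *m U) = sqn X.
Proof. by move=> Uu; apply: toC_inj; rewrite !sqnE trn_unitaryr. Qed.

Lemma sqnZ p q (c : C) (X : 'M[C]_(p, q)) :
  sqn (c *: X) = nsq c * sqn X.
Proof. by apply: toC_inj; rewrite rmorphM /= toC_nsq !sqnE trnZ. Qed.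

(** The exponential of the Hermitian matrix [U^t* *m diag(b) *m U]; replacing [b] by [t * b] traces
    a one-parameter group. *)
Definition hexp m (U : 'M[C]_m) (b : 'I_m -> R) : 'M[C]_m :=
  hdiag U (\row_j toC (expR (b j))).

Lemma hexpD m (U : 'M[C]_m) (b b' : 'I_m -> R) : U \is unitarymx ->
  hexp U b *m hexp U b' = hexp U (fun j => b j + b' j).
Proof.
move=> Uu; rewrite /hexp (hdiagM _ _ Uu); congr hdiag; apply/rowP => j.
by rewrite !mxE expRD rmorphM.
Qed.

Lemma adj_hexp m (U : 'M[C]_m) (b : 'I_m -> R) : (hexp U b)^t* = hexp U b.
Proof.
rewrite /hexp adj_hdiag; congr hdiag; apply/rowP => j.
by rewrite !mxE conj_toC.
Qed.

Lemma hexp0 m (U : 'M[C]_m) (b : 'I_m -> R) : U \is unitarymx ->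
  (forall j, b j = 0) -> hexp U b = 1%:M.
Proof.
move=> Uu b0; rewrite -(hdiag1 Uu); congr hdiag; apply/rowP => j.
by rewrite !mxE b0 expR0.
Qed.

Lemma hexp_inj m (U : 'M[C]_m) (b b' : 'I_m -> R) : U \is unitarymx ->
  hexp U b = hexp U b' -> b =1 b'.
Proof.
move=> Uu bb' j; apply: expR_inj; apply: toC_inj.
have := hdiag_diag (\row_j toC (expR (b j))) j Uu; rewrite -/(hexp U b) bb'.
by rewrite (hdiag_diag _ _ Uu) !mxE.
Qed.

Lemma hexp_iter m (U : 'M[C]_m) (b : 'I_m -> R) (X : set 'M[C]_m) :
    U \is unitarymx -> X 1%:M -> (forall g h, X g -> X h -> X (g *m h)) ->
  X (hexp U b) -> forall k : nat, X (hexp U (fun j => k%:R * b j)).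
Proof.
move=> Uu X1 XM Xb; elim=> [|k IH].
  by rewrite hexp0// => j; rewrite mul0r.
have -> : hexp U (fun j => k.+1%:R * b j) = hexp U b *m hexp U (fun j => k%:R * b j).
  by rewrite (hexpD _ _ Uu); congr hexp; apply: funext => j; rewrite -natr1; ring.
exact: XM.
Qed.

Lemma monomial_exp m (b : 'I_m -> R) mu :
  monomial (fun j => toC (expR (b j))) mu = toC (expR (\sum_j (mu j)%:R * b j)).
Proof.
rewrite /monomial expR_sum rmorph_prod; apply: eq_bigr => j _.
by rewrite expRM_natl rmorphXn.
Qed.

(* On the powers of a positive definite matrix a polynomial function is a
   combination of exponentials with distinct positive bases; vanishing at all
   natural exponents, it vanishes at all real ones. *)
Lemma hexp_real_powers m (U : 'M[C]_m) (b : 'I_m -> R) (X : set 'M[C]_m) :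
    algebraic X -> (forall k : nat, X (hexp U (fun j => k%:R * b j))) ->
  forall t : R, X (hexp U (fun j => t * b j)).
Proof.
move=> [S pS ->] Xk t f Sf; have [I [mu]] := polyfun_diag (pS f Sf).
move=> /(_ (U^t*) U)[c fE].
pose w (t : R) i := \sum_j (mu i j)%:R * (t * b j).
have wE s i : w s i = s * \sum_j (mu i j)%:R * b j.
  by rewrite mulr_sumr; apply: eq_bigr => j _; ring.
have fw s : f (hexp U (fun j => s * b j)) = \sum_i c i * toC (expR (w s i)).
  by rewrite /hexp /hdiag fE; apply: eq_bigr => i _; rewrite monomial_exp.
rewrite fw; apply: (power_sums_eq0 (x := fun i => toC (expR (w 1 i)))).
- move=> k; transitivity (f (hexp U (fun j => k%:R * b j))); last exact: Xk.
  rewrite fw; apply: eq_bigr => i _; rewrite -rmorphXn -expRM_natr.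
  by rewrite !wE; congr (_ * toC _); congr expR; ring.
- by move=> i j /toC_inj/expR_inj; rewrite !wE !mul1r => ->.
Qed.

Lemma sqn_mul_hexp m n (h U : 'M[C]_m) (b : 'I_m -> R) (X : 'M[C]_(m, n)) :
  h^t* *m h = hexp U b ->
  sqn (h *m X) = \sum_j expR (b j) * sqn (row j (U *m X)).
Proof.
move=> hU; apply: toC_inj; rewrite sqnE (trn_mul_hdiag _ hU) rmorph_sum.
by apply: eq_bigr => j _; rewrite mxE rmorphM /= sqnE.
Qed.

Lemma sqn_hexp_mul m n (U : 'M[C]_m) (b : 'I_m -> R) (X : 'M[C]_(m, n)) :
  U \is unitarymx ->
  sqn (hexp U b *m X) = \sum_j expR (2 * b j) * sqn (row j (U *m X)).
Proof.
move=> Uu; apply: sqn_mul_hexp.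
by rewrite adj_hexp (hexpD _ _ Uu); congr hexp; apply: funext => j; ring.
Qed.

Lemma hexp_fix m n (U : 'M[C]_m) (b : 'I_m -> R) (X : 'M[C]_(m, n)) :
    U \is unitarymx -> (forall j, b j = 0 \/ sqn (row j (U *m X)) = 0) ->
  hexp U b *m X = X.
Proof.
move=> Uu bX; apply: hdiag_fix => // j; rewrite mxE.
by case: (bX j) => [->|/eqP]; [left; rewrite expR0|rewrite sqn_eq0 => /eqP; right].
Qed.

(** The eigenvalues of the Gram matrix are nonnegative with product 1, hence positive, and their
    logarithms sum to 0. *)
Lemma polar_hexp m (h : 'M[C]_m) : \det h = 1 ->
  exists U b, [/\ U \is unitarymx, h^t* *m h = hexp U b & \sum_j b j = 0].
Proof.
move=> h1; have [U [d [Uu pE dE]]] := gram_hdiag h.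
pose s j := sqn (row j (U *m h^t*)).
have ds j : d 0 j = toC (s j) by rewrite dE sqnE.
have s1 : \prod_j s j = 1.
  apply: toC_inj; rewrite rmorph_prod /= -(eq_bigr _ (fun j _ => ds j)).
  by rewrite -(det_hdiag _ Uu) -pE det_gram h1 mulr1 rmorph1.
have s0 j : 0 < s j.
  rewrite lt_def sqn_ge0 andbT; apply/negP => /eqP sj0.
  by move/eqP: s1; rewrite (bigD1 j)//= sj0 mul0r eq_sym oner_eq0.
exists U, (fun j => ln (s j)); split; first exact: Uu.
  by rewrite pE /hexp; congr hdiag; apply/rowP => j; rewrite ds mxE lnK ?posrE.
apply: expR_inj; rewrite expR_sum expR0 -[in RHS]s1.
by apply: eq_bigr => j _; rewrite lnK ?posrE.
Qed.

End HermitianExponentials.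

(** * Limits along ultrafilters *)

Section Limits.
Context {R : realType}.
Local Notation C := (Cx R).

Lemma cvg_bigsum (K : numFieldType) (T : Type) (F : set_system T) (I : Type)
    (r : seq I) (P : pred I) (u : I -> T -> K) (l : I -> K) {FF : Filter F} :
    (forall i, u i t @[t --> F] --> l i) ->
  (\sum_(i <- r | P i) u i t) @[t --> F] --> \sum_(i <- r | P i) l i.
Proof.
move=> ul; elim: r => [|i r IH].
  by under eq_fun do rewrite big_nil; rewrite big_nil; exact: cvg_cst.
under eq_fun do rewrite big_cons; rewrite big_cons; case: (P i) => //.
by apply: cvgD.
Qed.

Lemma normC_toC (x : R) : `|toC x| = toC `|x| :> C.
Proof.
have nn (y : R) : 0 <= y -> 0 <= toC y.
  by rewrite -[0 in X in _ -> X](rmorph0 toC) ler_toC.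
have [x0|x0] := lerP 0 x; first by rewrite (ger0_norm x0) ger0_norm ?nn.
by rewrite (ltr0_norm x0) -[LHS]normrN -rmorphN ger0_norm// nn// oppr_ge0 ltW.
Qed.

Lemma cvg_eq_near (K : numFieldType) (T : Type) (F : set_system T)
    (u : T -> K) (l c : K) {FF : ProperFilter F} :
  u t @[t --> F] --> l -> (\forall t \near F, u t = c) -> l = c.
Proof.
move=> ul uc; apply: (@cvg_unique _ _ (u t @[t --> F])) => //.
exact: cvg_near_cst.
Qed.

Lemma gt0_toC (e : C) : 0 < e -> exists2 d : R, 0 < d & e = toC d.
Proof.
move=> e0; have [d ed] := toC_real (gtr0_real e0).
by exists d; rewrite // -ltr_toC rmorph0 -ed.
Qed.

Lemma cvg_toC (T : Type) (F : set_system T) (u : T -> R) (l : R) {FF : Filter F} :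
  (toC (u t) @[t --> F] --> toC l) <-> (u t @[t --> F] --> l).
Proof.
split => /cvgrPdist_lt ul; apply/cvgrPdist_lt => e e0.
  have := ul (toC e); rewrite -(rmorph0 toC) ltr_toC => /(_ e0).
  by apply: filterS => t; rewrite -rmorphB normC_toC ltr_toC.
have [d d0 ->] := gt0_toC e0; have := ul d d0.
by apply: filterS => t; rewrite -rmorphB normC_toC ltr_toC.
Qed.

Lemma toC_nsq_norm (z : C) : toC (nsq z) = `|z| ^+ 2.
Proof. by rewrite toC_nsq normCK. Qed.

Lemma cvg_nsq (T : Type) (F : set_system T) (u : T -> C) (l : C) {FF : Filter F} :
  u t @[t --> F] --> l -> nsq (u t) @[t --> F] --> nsq l.
Proof.
move=> ul; apply/cvg_toC; under eq_fun do rewrite toC_nsq_norm.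
rewrite toC_nsq_norm expr2; under eq_fun do rewrite expr2.
by apply: cvgM; exact: cvg_norm.
Qed.

Lemma cvg_conj (T : Type) (F : set_system T) (u : T -> C) (l : C) {FF : Filter F} :
  u t @[t --> F] --> l -> Num.conj (u t) @[t --> F] --> Num.conj l.
Proof.
move=> /cvgrPdist_lt ul; apply/cvgrPdist_lt => e e0; have := ul e e0.
by apply: filterS => t; rewrite -rmorphB norm_conjC.
Qed.

Lemma cvg_mx (K : topologicalType) (T : Type) (F : set_system T) p q
    (u : T -> 'M[K]_(p, q)) (L : 'M[K]_(p, q)) {FF : Filter F} :
  (u t @[t --> F] --> L) <-> (forall i j, u t i j @[t --> F] --> L i j).
Proof.
split => [uL i j A LA|uL A [P LP PA]].
  apply: (uL [set X | A (X i j)]).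
  exists (fun k l => [set x | k = i -> l = j -> A x]) => [k l|X]; last exact.
  have [[-> ->]|kl] := pselect (k = i /\ l = j).
    by apply: filterS LA => x Ax _ _.
  by apply: filterE => x ki lj; case: kl.
suff : F [set t | forall i j, P i j (u t i j)].
  by apply: (@filterS _ F) => t Pt; exact: PA.
apply: (@filter_forall _ _ (fun i t => forall j, P i j (u t i j))) => i.
apply: (@filter_forall _ _ (fun j t => P i j (u t i j))) => j.
by apply: uL; apply: LP.
Qed.

Lemma cvg_mulmx (T : Type) (F : set_system T) p q r
    (u : T -> 'M[C]_(p, q)) (v : T -> 'M[C]_(q, r))
    (U : 'M[C]_(p, q)) (V : 'M[C]_(q, r)) {FF : Filter F} :
  u t @[t --> F] --> U -> v t @[t --> F] --> V -> u t *m v t @[t --> F] --> U *m V.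
Proof.
move=> /cvg_mx uU /cvg_mx vV; apply/cvg_mx => i j.
rewrite mxE; under eq_fun do rewrite mxE.
apply: (@cvg_bigsum C _ _ _ _ _ (fun k t => u t i k * v t k j)) => k.
by apply: cvgM; [exact: uU|exact: vV].
Qed.

Lemma cvg_adj (T : Type) (F : set_system T) p q
    (u : T -> 'M[C]_(p, q)) (U : 'M[C]_(p, q)) {FF : Filter F} :
  u t @[t --> F] --> U -> (u t)^t* @[t --> F] --> U^t*.
Proof.
move=> /cvg_mx uU; apply/cvg_mx => i j.
by rewrite !mxE; under eq_fun do rewrite !mxE; exact: cvg_conj.
Qed.

Lemma cvg_sqn (T : Type) (F : set_system T) p q
    (u : T -> 'M[C]_(p, q)) (U : 'M[C]_(p, q)) {FF : Filter F} :
  u t @[t --> F] --> U -> sqn (u t) @[t --> F] --> sqn U.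
Proof.
move=> /cvg_mx uU.
apply: (@cvg_bigsum R _ _ _ _ _ (fun i t => \sum_j nsq (u t i j))) => i.
apply: (@cvg_bigsum R _ _ _ _ _ (fun j t => nsq (u t i j))) => j.
exact: cvg_nsq.
Qed.

Lemma cvg_row (T : Type) (F : set_system T) p q
    (u : T -> 'M[C]_(p, q)) (U : 'M[C]_(p, q)) i {FF : Filter F} :
  u t @[t --> F] --> U -> row i (u t) @[t --> F] --> row i U.
Proof.
move=> /cvg_mx uU; apply/cvg_mx => k j.
by rewrite !mxE; under eq_fun do rewrite !mxE; exact: uU.
Qed.

Lemma cvg_hexp (T : Type) (F : set_system T) m
    (u : T -> 'M[C]_m) (U : 'M[C]_m) (b : T -> 'I_m -> R) B {FF : Filter F} :
    u t @[t --> F] --> U -> (forall j, b t j @[t --> F] --> B j) ->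
  hexp (u t) (b t) @[t --> F] --> hexp U B.
Proof.
move=> uU bB.
have D : diag_mx (\row_j toC (expR (b t j))) @[t --> F] -->
    diag_mx (\row_j toC (expR (B j))).
  apply/cvg_mx => i j; rewrite !mxE; under eq_fun do rewrite !mxE.
  case: (i == j); last by under eq_fun do rewrite mulr0n; exact: cvg_cst.
  under eq_fun do rewrite mulr1n; apply/cvg_toC.
  apply: (cvg_comp (fun t => b t i) expR (bB i)); exact: continuous_expR.
have DU := cvg_mulmx (cvg_mulmx (cvg_adj uU) D) uU.
rewrite /hexp /hdiag; exact: DU.
Qed.

Lemma cvg_unitary (T : Type) (F : set_system T) m
    (u : T -> 'M[C]_m) (U : 'M[C]_m) {FF : ProperFilter F} :
  u t @[t --> F] --> U -> (\forall t \near F, u t \is unitarymx) ->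
  U \is unitarymx.
Proof.
move=> uU uu; apply/unitarymxP/matrixP => i j.
have UU : u t *m (u t)^t* @[t --> F] --> U *m U^t*.
  exact: (cvg_mulmx uU (cvg_adj uU)).
move/cvg_mx : UU => /(_ i j) UU.
apply: cvg_eq_near UU _; apply: filterS uu => t /unitarymxP ->.
by [].
Qed.

(** Compactness of a segment; ultrafilters take the place of convergent subsequences. *)
Lemma bounded_ultra_cvg (T : Type) (F : set_system T) (u : T -> R) (B : R) :
    UltraFilter F -> (\forall t \near F, `|u t| <= B) ->
  exists l : R, u t @[t --> F] --> l.
Proof.
move=> FU uB; have := @segment_compact R (- B) B; rewrite compact_ultra.
(* Of a preimage and its complement one lies in [F], so the image filter is again maximal. *)
have FuU : UltraFilter (fmap u F).
  split=> [|G PG FG]; first exact: fmap_proper_filter.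
  apply/seteqP; split => // A GA.
  have [//|FA] := in_ultra_setVsetC (u @^-1` A) FU.
  have : G (A `&` ~` A) by apply: filterI GA _; apply: FG.
  by rewrite setICr => /filter_not_empty.
move=> /(_ (fmap u F) FuU)[|l [_ ul]]; last by exists l.
by apply: filterS uB => t; rewrite /= in_itv/= ler_norml.
Qed.

Lemma bounded_ultra_cvgC (T : Type) (F : set_system T) (u : T -> C) (B : R) :
    UltraFilter F -> (\forall t \near F, nsq (u t) <= B) ->
  exists l : C, u t @[t --> F] --> l.
Proof.
move=> FU uB.
have sB (x : R) : x ^+ 2 <= B -> `|x| <= Num.sqrt B.
  by move=> xB; rewrite -sqrtr_sqr ler_wsqrtr.
have [|x ux] := @bounded_ultra_cvg _ F (fun t => reC (u t)) (Num.sqrt B) FU.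
  by apply: filterS uB => t /(le_trans (le_Re_nsq _)); exact: sB.
have [|y uy] := @bounded_ultra_cvg _ F (fun t => imC (u t)) (Num.sqrt B) FU.
  by apply: filterS uB => t /(le_trans (le_Im_nsq _)); exact: sB.
exists (toC x + iC * toC y).
have -> : u = fun t => toC (reC (u t)) + iC * toC (imC (u t)).
  by apply: funext => t; exact: Cx_rect.
by apply: cvgD; [exact/cvg_toC|apply: cvgM; [exact: cvg_cst|exact/cvg_toC]].
Qed.

Lemma bounded_ultra_cvg_mx (T : Type) (F : set_system T) p q
    (u : T -> 'M[C]_(p, q)) (B : R) :
    UltraFilter F -> (\forall t \near F, sqn (u t) <= B) ->
  exists L : 'M[C]_(p, q), u t @[t --> F] --> L.
Proof.
move=> FU uB.
have /choice[L uL] : forall ij, exists l : C, u t ij.1 ij.2 @[t --> F] --> l.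
  move=> [i j]; apply: (@bounded_ultra_cvgC _ F _ B) => //=.
  by apply: filterS uB => t; apply: le_trans; exact: le_entry_sqn.
exists (\matrix_(i, j) L (i, j)); apply/cvg_mx => i j; rewrite mxE.
exact: (uL (i, j)).
Qed.

Lemma polyfun_cvg (T : Type) (F : set_system T) m (f : 'M[C]_m -> C)
    (u : T -> 'M[C]_m) (U : 'M[C]_m) {FF : Filter F} : polyfun f ->
  u t @[t --> F] --> U -> f (u t) @[t --> F] --> f U.
Proof.
move=> pf /cvg_mx uU; elim: pf => {f} [c|i j|f h _ fU _ hU|f h _ fU _ hU].
- exact: cvg_cst.
- exact: uU.
- exact: (cvgD fU hU).
- exact: (cvgM fU hU).
Qed.

(** The equations of [X] are tested one at a time: [u] need not meet [X], and how far out an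
    equation starts to hold may depend on the equation. *)
Lemma algebraic_cvg (T : Type) (F : set_system T) m (X : set 'M[C]_m)
    (u : T -> 'M[C]_m) (U : 'M[C]_m) {FF : ProperFilter F} : algebraic X ->
    u t @[t --> F] --> U ->
    (forall f, polyfun f -> (forall g, X g -> f g = 0) ->
      \forall t \near F, f (u t) = 0) ->
  X U.
Proof.
move=> [S pS ->] uU uX f Sf.
apply: cvg_eq_near (polyfun_cvg (pS f Sf) uU) _.
by apply: (uX f) => [|g]; [exact: pS|exact].
Qed.

Lemma algebraic_closed m (X : set 'M[C]_m) : algebraic X -> closed X.
Proof.
move=> aX U; rewrite closureEcvg => -[F FF [FU FX]].
apply: (@algebraic_cvg _ F _ X id U) => // f _ Xf.
by apply: FX => g /Xf.
Qed.

Lemma closure_ultra (T : topologicalType) (X : set T) (x : T) : closure X x ->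
  exists2 F : set_system T, UltraFilter F & F --> x /\ F X.
Proof.
rewrite closureEcvg => -[F FF [Fx FX]].
have [G [GU FG]] := ultraFilterLemma FF; exists G => //.
by split; [exact: subset_trans FG|apply/FG/FX].
Qed.

Lemma cvg_ler (T : Type) (F : set_system T) (u : T -> R) (l c : R)
    {FF : ProperFilter F} :
  u t @[t --> F] --> l -> (\forall t \near F, u t <= c) ->
  l <= c.
Proof.
move=> ul uc.
exact: (@closed_cvg _ _ F _ u [set x | x <= c] (@closed_le R c) uc l ul).
Qed.

(** Points whose squared norm approaches the infimum stay bounded, so they converge along an
    ultrafilter, and the limit lies in the closed set. *)
Lemma closed_min_sqn p q (X : set 'M[C]_(p, q)) : closed X -> X !=set0 ->
  exists2 x, X x & forall y, X y -> sqn x <= sqn y.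
Proof.
move=> cX [x0 Xx0]; pose S := [set sqn x | x in X].
have iS : has_inf S.
  split; first by exists (sqn x0), x0.
  by exists 0 => _ [x _ <-]; exact: sqn_ge0.
pose B (e : R) := [set x | X x /\ sqn x < inf S + e].
have FF : ProperFilter (filter_from [set e : R | 0 < e] B).
  apply: filter_from_proper => [|e /= e0].
    apply: filter_from_filter => [|e d /= e0 d0]; first by exists 1 => /=.
    exists (Num.min e d) => /=; first by rewrite lt_min e0.
    move=> x [Xx]; rewrite -ltrBlDl lt_min !ltrBlDl => /andP[xe xd].
    by split; split.
  have [_ [x Xx <-] xe] := inf_adherent e0 iS.
  by exists x; split.
have [G [GU FG]] := ultraFilterLemma FF.
have GB e : 0 < e -> G (B e) by move=> e0; apply: FG; exists e.
have [|L GL] := @bounded_ultra_cvg_mx _ G _ _ id (inf S + 1) GU.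
  by apply: filterS (GB 1 ltr01) => x [_ /ltW].
exists L.
  apply: (closed_cvg X cX _ L GL).
  by apply: filterS (GB 1 ltr01) => x [].
move=> y Xy; apply: (@le_trans _ _ (inf S)); last first.
  by apply: ge_inf; [exact: iS.2|exists y].
apply/ler_addgt0Pl => e e0; rewrite addrC; apply: cvg_ler (cvg_sqn GL) _.
by apply: filterS (GB e e0) => x [_ /ltW].
Qed.

End Limits.

(** * Kempf-Ness theory *)

Section KempfNess.
Context {R : realType}.
Local Notation C := (Cx R).

(** The exponential sum is a function of [t] with a minimum at 0, and its derivative there is
    [\sum_j b j * w j]. *)
Lemma exp_sum_critical m (b w : 'I_m -> R) :
    (forall t, \sum_j w j <= \sum_j expR (t * b j) * w j) ->
  \sum_j b j * w j = 0.
Proof.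
move=> fmin; pose h j := w j \*: (expR \o (b j \*: (@id R))).
pose f : R -> R := \sum_(j < m) h j.
have fE t : f t = \sum_j expR (t * b j) * w j.
  rewrite /f fct_sumE; apply: eq_bigr => j _.
  by rewrite /h /= /GRing.scale /= mulrC [b j * t]mulrC.
have df (t : R) : is_derive t (1 : R) f
    (\sum_j w j *: (expR (b j *: t) * (b j *: (1 : R)))%R).
  apply: is_derive_sum => j; apply: is_deriveZ; apply: is_derive1_comp.
have d0 : is_derive (0 : R) 1 f 0.
  apply: (@derive1_at_min _ f (-1) 1).
  - by lra.
  - by move=> t _; case: (df t).
  - by rewrite in_itv/= ltrN10 ltr01.
  - move=> t _; rewrite !fE; apply: le_trans (fmin t).
    by apply: ler_sum => j _; rewrite mul0r expR0 mul1r.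
have [_ d00] := d0; have [_ df0] := df 0; rewrite -[RHS]d00 df0.
by apply: eq_bigr => j _; rewrite scaler0 expR0 mul1r /GRing.scale /= mulr1 mulrC.
Qed.

(** Since [1 + x <= expR x] with equality only at 0, the terms [(expR (b j) - (1 + b j)) * w j] are
    nonnegative, and the hypotheses make their sum vanish. *)
Lemma exp_sum_eq m (b w : 'I_m -> R) : (forall j, 0 <= w j) ->
    \sum_j b j * w j = 0 -> \sum_j expR (b j) * w j = \sum_j w j ->
  forall j, b j = 0 \/ w j = 0.
Proof.
move=> w0 bw0 ew j.
have term0 i : 0 <= (expR (b i) - (1 + b i)) * w i.
  by rewrite mulr_ge0// subr_ge0 expR_ge1Dx.
have : \sum_i (expR (b i) - (1 + b i)) * w i = 0.
  under eq_bigr do rewrite mulrBl mulrDl mul1r.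
  by rewrite sumrB big_split/= bw0 ew addr0 subrr.
move=> /eqP; rewrite psumr_eq0 ?(fun_if, term0)// => /allP/(_ j).
rewrite mem_index_enum => /(_ isT)/=; rewrite mulf_eq0 subr_eq0.
move=> /orP[/eqP eb|/eqP]; last by right.
by left; apply: contra_eq eb => /expR_gt1Dx; rewrite lt_neqAle eq_sym => /andP[].
Qed.

(** The properties of [SL_part G] on which the Kempf-Ness argument rests. *)
Record selfadjoint_SL m (H : set 'M[C]_m) : Prop := SelfadjointSL {
  sa_alg : algebraic H;
  sa_det : forall g, H g -> \det g = 1;
  sa1 : H 1%:M;
  saM : forall g h, H g -> H h -> H (g *m h);
  saV : forall g, H g -> H (invmx g);
  sa_adj : forall g, H g -> H (g^t*) }.

(** The group contains [h^t* *m h] and its natural powers, hence, being algebraic, its real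
    powers. *)
Lemma selfadjoint_gram m (H : set 'M[C]_m) h : selfadjoint_SL H -> H h ->
  exists U b, [/\ U \is unitarymx, h^t* *m h = hexp U b, \sum_j b j = 0 &
    forall t, H (hexp U (fun j => t * b j))].
Proof.
move=> HS Hh; have [U [b [Uu hU b0]]] := polar_hexp (sa_det HS Hh).
exists U, b; split => //; apply: hexp_real_powers (sa_alg HS) _.
apply: hexp_iter Uu (sa1 HS) (saM HS) _.
by rewrite -hU; apply: saM => //; exact: sa_adj.
Qed.

Definition minimal m n (H : set 'M[C]_m) (Z : 'M[C]_(m, n)) :=
  forall h, H h -> sqn Z <= sqn (h *m Z).

Lemma sqn_rows m n (U : 'M[C]_m) (Z : 'M[C]_(m, n)) : U \is unitarymx ->
  \sum_j sqn (row j (U *m Z)) = sqn Z.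
Proof.
move=> Uu; rewrite -(sqn_unitaryl Z Uu); apply: eq_bigr => i _.
by rewrite /sqn big_ord1; apply: eq_bigr => j _; rewrite !mxE.
Qed.

(* The vanishing of the moment map at a vector of minimal norm. *)
Lemma minimal_moment m n (H : set 'M[C]_m) (Z : 'M[C]_(m, n))
    (U : 'M[C]_m) (b : 'I_m -> R) :
    minimal H Z -> U \is unitarymx ->
    (forall t, H (hexp U (fun j => t * b j))) ->
  \sum_j b j * sqn (row j (U *m Z)) = 0.
Proof.
move=> Zmin Uu Hb; apply: exp_sum_critical => t; rewrite sqn_rows//.
(* Half of [t], because squaring the norm doubles the exponent. *)
apply: le_trans (Zmin _ (Hb (t / 2))) _; rewrite (sqn_hexp_mul _ _ Uu).
by apply: ler_sum => j _; rewrite mulrA [2 * _]mulrC divfK.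
Qed.

(** The moment vanishes and the exponential sum keeps its value, so [b] vanishes at every nonzero
    row of [U *m Z]. *)
Lemma minimal_gram_fix m n (H : set 'M[C]_m) (Z : 'M[C]_(m, n))
    (h U : 'M[C]_m) (b : 'I_m -> R) :
    minimal H Z -> U \is unitarymx ->
    (forall t, H (hexp U (fun j => t * b j))) ->
    h^t* *m h = hexp U b -> sqn (h *m Z) = sqn Z ->
  forall t, hexp U (fun j => t * b j) *m Z = Z.
Proof.
move=> Zmin Uu Hb hU hZ t; apply: hexp_fix => // j.
have bw := minimal_moment Zmin Uu Hb.
move: hZ; rewrite (sqn_mul_hexp _ hU) -[RHS](sqn_rows Z Uu) => hZ.
have [->|->] := exp_sum_eq (fun j => sqn_ge0 _) bw hZ j; last by right.
by left; rewrite mulr0.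
Qed.

Lemma algebraic_stabilizer m n (H : set 'M[C]_m) (Z : 'M[C]_(m, n)) :
  algebraic H -> algebraic (stabilizer H Z).
Proof. by move=> aH; apply: algebraicI => //; exact: algebraic_mulmx_eq. Qed.

(** The elements of [H] taking [Z] to [W] form a closed coset of the stabilizer of [Z], on which the
    norm attains its minimum. *)
Lemma least_representative m n (H : set 'M[C]_m) (Z W : 'M[C]_(m, n)) :
    selfadjoint_SL H -> Defs.orbit H Z W ->
  exists h : 'M[C]_m, [/\ H h, h *m Z = W &
    forall s, stabilizer H Z s -> sqn h <= sqn (h *m s)].
Proof.
move=> HS [h0 Hh0 h0Z].
have [| |h [Hh hZ] hmin] := @closed_min_sqn _ _ _ (H `&` [set g | g *m Z = W]).
- by apply: algebraic_closed; apply: algebraicI (sa_alg HS) _; exact: algebraic_mulmx_eq.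
- by exists h0.
exists h; split => // s [Hs sZ]; apply: hmin; split; first exact: saM.
by rewrite /= -mulmxA sZ.
Qed.

Lemma sqn_eigenrow m (U : 'M[C]_m) (b : 'I_m -> R) j : U \is unitarymx ->
  sqn (row j (U *m hexp U b)) = expR (2 * b j).
Proof.
move=> Uu; rewrite /hexp /hdiag !mulmxA (unitarymxP Uu) mul1mx mul_diag_mx.
have -> : row j (\matrix_(i, k) ((\row_l toC (expR (b l))) 0 i * U i k)) =
    toC (expR (b j)) *: row j U.
  by apply/rowP => k; rewrite !mxE.
rewrite sqnZ; apply: toC_inj; rewrite rmorphM /= toC_nsq conj_toC sqnE.
have -> : trn (row j U) = 1.
  have /unitarymxP/matrixP/(_ j j) := Uu; rewrite !mxE eqxx mulr1n => <-.
  rewrite trnE big_ord1; apply: eq_bigr => k _; by rewrite !mxE.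
by rewrite mulr1 -rmorphM -expRD mulr_natl mulr2n.
Qed.

Lemma cvg_ratio_pinfty (T : Type) (F : set_system T) (tau y : T -> R) (l : R)
    {FF : Filter F} : (forall B, \forall x \near F, B < tau x) ->
    y x / tau x @[x --> F] --> l -> 0 < l ->
  forall B, \forall x \near F, B <= y x.
Proof.
move=> tauoo yl l0 B.
have H1 : \forall x \near F, l / 2 < y x / tau x.
  by apply: (cvgr_gt l yl); lra.
(* The 0 makes [tau x] positive, so that the division can be cleared; with [2 * B / l] the bound
   [l / 2 * tau x] exceeds [B]. *)
apply: filterS2 H1 (tauoo (Num.max 0 (2 * B / l))) => x.
rewrite gt_max => + /andP[t0 Bt]; rewrite ltr_pdivlMr// => ly.
by apply: le_trans (ltW ly); move: Bt; rewrite ltr_pdivrMr//; lra.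
Qed.

End KempfNess.

(** * Boundedness of least representatives *)

Section ClosedOrbit.
Context {R : realType}.
Local Notation C := (Cx R).

Lemma sqn_row_le p q (X : 'M[C]_(p, q)) j : sqn (row j X) <= sqn X.
Proof.
rewrite /sqn big_ord1 [leRHS](bigD1 j)//=.
under eq_bigr do rewrite mxE; rewrite lerDl.
by do 2![apply: sumr_ge0 => ? _]; exact: nsq_ge0.
Qed.

Lemma sqn_row_unitary m (U : 'M[C]_m) j : U \is unitarymx -> sqn (row j U) = 1.
Proof.
move=> Uu; have := sqn_eigenrow (fun=> 0) j Uu.
by rewrite (hexp0 Uu (fun=> erefl)) mulmx1 mulr0 expR0.
Qed.

Lemma sqn_unitary m (U : 'M[C]_m) : U \is unitarymx -> sqn U = m%:R.
Proof.
move=> Uu; rewrite -(mulmx1 U) (sqn_unitaryl _ Uu) -(sqn_rows 1%:M Uu) mulmx1.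
rewrite (eq_bigr (fun=> 1)) => [|j _]; last exact: sqn_row_unitary.
by rewrite sumr_const card_ord.
Qed.

(* If [tau = \sum_j `|b j|] were unbounded, then the limit of [hexp U (b / tau)]
   would generate a one-parameter subgroup of the stabilizer of [Z]: along it the
   norm of [Z] is critical and stays bounded. Multiplying [h] by an element of
   this subgroup would decrease the norm of [h]. *)
Lemma unbounded_not_least (T : Type) (F : set_system T) m n (H : set 'M[C]_m)
    (Z : 'M[C]_(m, n)) (h U : T -> 'M[C]_m) (b : T -> 'I_m -> R) (K : R) :
    UltraFilter F -> selfadjoint_SL H -> minimal H Z ->
    (\forall t \near F, U t \is unitarymx) ->
    (\forall t \near F, (h t)^t* *m h t = hexp (U t) (b t)) ->
    (\forall t \near F, \sum_j b t j = 0) ->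
    (\forall t \near F, forall s, H (hexp (U t) (fun j => s * b t j))) ->
    (\forall t \near F, forall s, stabilizer H Z s -> sqn (h t) <= sqn (h t *m s)) ->
    (\forall t \near F, sqn (h t *m Z) <= K) ->
    (forall B, \forall t \near F, B < \sum_j `|b t j|) ->
  False.
Proof.
move=> FU HS Zmin Uu hU b0 Hb hmin hZ tauoo.
pose tau t := \sum_j `|b t j|.
have tau0 : \forall t \near F, 0 < tau t by exact: tauoo.
have [V UV] : exists V : 'M[C]_m, U t @[t --> F] --> V.
  apply: (@bounded_ultra_cvg_mx _ _ F _ _ U m%:R FU).
  by apply: filterS Uu => t /sqn_unitary ->.
have Vu : V \is unitarymx by exact: cvg_unitary UV Uu.
have /choice[a ba] : forall j, exists l : R, b t j / tau t @[t --> F] --> l.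
  move=> j; apply: (@bounded_ultra_cvg _ _ F _ 1 FU).
  apply: filterS tau0 => t t0; rewrite normrM normfV (gtr0_norm t0) ler_pdivrMr//.
  by rewrite mul1r /tau (bigD1 j)//= lerDl sumr_ge0.
have a0 : \sum_j a j = 0.
  apply: (cvg_eq_near (F := F) (u := fun t => \sum_j b t j / tau t)).
    by apply: (@cvg_bigsum R T F _ _ _ (fun j t => b t j / tau t) a) => j; exact: ba.
  by apply: filterS b0 => t bt; rewrite -mulr_suml bt mul0r.
have a1 : \sum_j `|a j| = 1.
  apply: (cvg_eq_near (F := F) (u := fun t => \sum_j `|b t j / tau t|)).
    apply: (@cvg_bigsum R T F _ _ _ (fun j t => `|b t j / tau t|) (fun j => `|a j|)) => j.
    exact: cvg_norm (ba j).
  apply: filterS tau0 => t t0.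
  under eq_bigr do rewrite normrM normfV (gtr0_norm t0).
  by rewrite -mulr_suml divff// gt_eqF.
(* The exponents [s * (b t j / tau t)] belong to the parameter [s / tau t], so the approximants lie
   in the closed set [H]. *)
have HV s : H (hexp V (fun j => s * a j)).
  apply: (closed_cvg H (algebraic_closed (sa_alg HS)) _ _
    (cvg_hexp (u := U) (b := fun t j => s * (b t j / tau t)) UV _)); last first.
    by move=> j; apply: cvgM; [exact: cvg_cst|exact: ba].
  apply: filterS Hb => t /(_ (s / tau t)).
  have -> : (fun j => s / tau t * b t j) = fun j => s * (b t j / tau t); last exact.
  by apply: funext => j; rewrite mulrAC mulrA.
pose w t j := sqn (row j (U t *m Z)); pose v j := sqn (row j (V *m Z)).
have wv j : w t j @[t --> F] --> v j.
  apply: cvg_sqn; apply: cvg_row; apply: cvg_mulmx UV _; exact: cvg_cst.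
(* If [a j] is positive, then [b t j] tends to infinity, while [expR (b t j) * w t j] is at most
   [K]; so [w t j] tends to 0. *)
have v_pos j : 0 < a j -> v j = 0.
  move=> aj0; apply/eqP; rewrite eq_le sqn_ge0 andbT.
  apply/ler_addgt0Pl => e e0; rewrite addr0; apply: cvg_ler (wv j) _.
  (* The main estimate divides by [K]; for [K <= 0] the sum bounding [w t j] is itself
     nonpositive. *)
  have [K0|K0] := ltP 0 K; last first.
    apply: filterS2 hZ hU => t htZ htU.
    have := le_trans htZ K0; rewrite (sqn_mul_hexp _ htU) => s0.
    suff : expR (b t j) * w t j <= 0.
      by rewrite pmulr_rle0 ?expR_gt0// => /le_trans; apply; exact: ltW.
    apply: le_trans s0; rewrite (bigD1 j)//= lerDl sumr_ge0// => i _.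
    by rewrite mulr_ge0 ?expR_ge0 ?sqn_ge0.
  apply: filterS3 hZ hU (cvg_ratio_pinfty tauoo (ba j) aj0 (K / e)) => t htZ htU bt.
  have : expR (b t j) * w t j <= K.
    apply: le_trans htZ; rewrite (sqn_mul_hexp _ htU) (bigD1 j)//= lerDl.
    by apply: sumr_ge0 => i _; rewrite mulr_ge0 ?expR_ge0 ?sqn_ge0.
  have eb : K / e <= expR (b t j).
    by apply: le_trans (expR_ge1Dx _); lra.
  have w0 : 0 <= w t j by exact: sqn_ge0.
  move=> /(le_trans (ler_wpM2r w0 eb)).
  by rewrite mulrAC ler_pdivrMr// ler_pM2l.
have av : \sum_j a j * v j = 0.
  by apply: (minimal_moment Zmin Vu) => s; exact: HV.
(* By [v_pos] no term [a j * v j] is positive, and they sum to 0. *)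
have av0 j : a j = 0 \/ v j = 0.
  have : \sum_i - (a i * v i) = 0 by rewrite sumrN av oppr0.
  have npos i : 0 <= - (a i * v i).
    have [/v_pos ->|ai0] := ltP 0 (a i); first by rewrite mulr0 oppr0.
    by rewrite oppr_ge0 mulr_le0_ge0 ?sqn_ge0.
  move=> /eqP; rewrite psumr_eq0 => [/allP/(_ j)|i _]; last exact: npos.
  rewrite mem_index_enum => /(_ isT)/=; rewrite oppr_eq0 mulf_eq0.
  by move=> /orP[]/eqP; [left|right].
(* The element shortening [h t]: the rows of [V *m s] have squared norms [expR (- a j)], less than 1
   where [a j] is positive. *)
pose s := hexp V (fun j => - (a j / 2)).
have sZ : stabilizer H Z s.
  split.
    rewrite /s (_ : (fun j => - (a j / 2)) = fun j => - (1 / 2) * a j); first exact: HV.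
    by apply: funext => j; lra.
  by apply: hexp_fix => // j; case: (av0 j) => [->|]; [left; rewrite mul0r oppr0|right].
pose c t j := sqn (row j (U t *m s)).
have cE j : c t j @[t --> F] --> expR (- a j).
  have -> : expR (- a j) = sqn (row j (V *m s)).
    by rewrite sqn_eigenrow//; congr expR; lra.
  apply: cvg_sqn; apply: cvg_row; apply: cvg_mulmx UV _; exact: cvg_cst.
have [J aJ] : exists J, 0 < a J.
  apply: contrapT => /forallNP aneg; suff : \sum_j `|a j| = 0.
    by rewrite a1 => /eqP; rewrite oner_eq0.
  rewrite (eq_bigr (fun j => - a j)) ?sumrN ?a0 ?oppr0// => j _.
  by rewrite ler0_norm// leNgt; apply/negP/aneg.
(* Term [J] will be below [- (d / 2) * expR (b t J)] and every other term at most
   [e * expR (b t J)]; [e] is chosen so that [e * m < d / 2], and [m + 1] keeps this strict. *)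
pose d := 1 - expR (- a J).
have d0 : 0 < d by rewrite subr_gt0 expR_lt1 oppr_lt0.
pose e := d / (2 * (m%:R + 1)).
have m1 : 0 < m%:R + 1 :> R by rewrite ltr_wpDl.
have e0 : 0 < e by rewrite divr_gt0// mulr_gt0.
have cJ : \forall t \near F, c t J - 1 < - (d / 2).
  have : \forall t \near F, c t J < 1 - d / 2.
    by apply: (cvgr_lt _ (cE J)); rewrite -/d /d in d0 *; lra.
  by apply: filterS => t; lra.
(* For [a j > 0] the left side is nonpositive. Otherwise [a j < a J], so [b t J - b t j] tends to
   infinity and [expR (b t j)] is negligible. *)
have other j : \forall t \near F, expR (b t j) * (c t j - 1) <= expR (b t J) * e.
  have [aj0|aj0] := ltP 0 (a j).
    have : \forall t \near F, c t j < 1.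
      by apply: (cvgr_lt _ (cE j)); rewrite expR_lt1 oppr_lt0.
    apply: filterS => t ct; apply: (@le_trans _ _ 0).
      by rewrite mulr_ge0_le0 ?expR_ge0// subr_le0 ltW.
    by rewrite mulr_ge0 ?expR_ge0 ?ltW.
  have diff : (b t J - b t j) / tau t @[t --> F] --> a J - a j.
    under eq_fun do rewrite mulrBl; exact: cvgB.
  have aJj : 0 < a J - a j by rewrite subr_gt0 (le_lt_trans aj0).
  apply: filterS2 Uu (cvg_ratio_pinfty tauoo diff aJj (sqn s / e)) => t Ut bt.
  have ct : c t j <= sqn s.
    by apply: le_trans (sqn_row_le _ _) _; rewrite sqn_unitaryl.
  have := expR_ge1Dx (b t J - b t j); rewrite expRD expRN => /(le_trans _).
  move=> /(_ (sqn s / e)) /(_ ltac:(lra)).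
  rewrite ler_pdivlMr ?expR_gt0// => sb.
  apply: (@le_trans _ _ (expR (b t j) * sqn s)).
    by rewrite ler_wpM2l ?expR_ge0//; lra.
  by rewrite mulrC -ler_pdivrMr// mulrAC.
have alle : \forall t \near F, forall j, expR (b t j) * (c t j - 1) <= expR (b t J) * e.
  exact: (@filter_forall _ _ (fun j t => expR (b t j) * (c t j - 1) <= expR (b t J) * e)).
(* The minimality of [h t] compared with [h t *m s], both norms expanded in the eigenbasis. *)
have good : \forall t \near F, 0 <= \sum_j expR (b t j) * (c t j - 1).
  apply: filterS3 Uu hU hmin => t Ut htU /(_ s sZ).
  rewrite -[X in sqn X <= _]mulmx1 !(sqn_mul_hexp _ htU) => hs.
  under eq_bigr do rewrite mulrBr mulr1.
  rewrite sumrB subr_ge0; apply: le_trans hs; apply: ler_sum => j _.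
  by rewrite mulmx1 sqn_row_unitary// mulr1.
have [t [ct [et gt]]] := filter_ex (filterI cJ (filterI alle good)).
move: gt; rewrite leNgt => /negP; apply; rewrite (bigD1 J)//=.
apply: (@le_lt_trans _ _ (expR (b t J) * (c t J - 1) + \sum_(j < m) expR (b t J) * e)).
  rewrite lerD2l [leRHS](bigD1 J)//= -[leLHS]add0r lerD//.
    by rewrite mulr_ge0 ?expR_ge0 ?ltW.
  by apply: ler_sum => j _; exact: et.
rewrite sumr_const card_ord -mulr_natr -mulrA -mulrDr pmulr_rlt0 ?expR_gt0//.
have : e * m%:R < d / 2.
  rewrite /e mulrAC ltr_pdivrMr ?mulr_gt0// mulrA divfK//.
  by rewrite ltr_pM2l// ltrDl.
by move: ct; lra.
Qed.

End ClosedOrbit.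

(** * Minimal vectors have closed orbits *)

Section KempfNessTheorem.
Context {R : realType}.
Local Notation C := (Cx R).

Lemma sqn_gram m (h U : 'M[C]_m) (b : 'I_m -> R) : U \is unitarymx ->
  h^t* *m h = hexp U b -> sqn h = \sum_j expR (b j).
Proof.
move=> Uu hU; rewrite -[X in sqn X]mulmx1 (sqn_mul_hexp _ hU).
by apply: eq_bigr => j _; rewrite mulmx1 sqn_row_unitary// mulr1.
Qed.

Lemma cvg_mx_unique (T : Type) (F : set_system T) p q (u : T -> 'M[C]_(p, q))
    (A B : 'M[C]_(p, q)) {FF : ProperFilter F} :
  u t @[t --> F] --> A -> u t @[t --> F] --> B -> A = B.
Proof.
move=> /cvg_mx uA /cvg_mx uB; apply/matrixP => i j.
exact: (cvg_unique (@norm_hausdorff _ _) (uA i j) (uB i j)).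
Qed.

(** A limit point [W] is approached by [h x *m Z] with least [h x]. If the exponents of [h x] are
    bounded, then [h x] converges to some [L] in [H] with [L *m Z = W]; the other case is
    [unbounded_not_least]. *)
Theorem closed_orbit_minimal m n (H : set 'M[C]_m) (Z : 'M[C]_(m, n)) :
  selfadjoint_SL H -> minimal H Z -> closed (Defs.orbit H Z).
Proof.
move=> HS Zmin W /closure_ultra[F FU [FW Forb]].
have /choice[h hP] : forall x, exists h : 'M[C]_m, Defs.orbit H Z x ->
    [/\ H h, h *m Z = x &
    forall s, stabilizer H Z s -> sqn h <= sqn (h *m s)].
  move=> x; have [/(least_representative HS)[h hP]|nx] := pselect (Defs.orbit H Z x).
    by exists h.
  (* An arbitrary value: [F] contains the orbit. *)
  by exists 0.
have /choice[Ub UbP] : forall x, exists Ub : 'M[C]_m * ('I_m -> R),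
    Defs.orbit H Z x -> [/\ Ub.1 \is unitarymx, (h x)^t* *m h x = hexp Ub.1 Ub.2,
      \sum_j Ub.2 j = 0 & forall t, H (hexp Ub.1 (fun j => t * Ub.2 j))].
  move=> x; have [/hP[Hh _ _]|nx] := pselect (Defs.orbit H Z x).
    by have [U [b ?]] := selfadjoint_gram HS Hh; exists (U, b).
  by exists (0, fun=> 0).
pose tau x := \sum_j `|(Ub x).2 j|.
have hZW : h x *m Z @[x --> F] --> W.
  suff E : \forall x \near F, x = h x *m Z.
    by apply: cvg_trans FW; apply: near_eq_cvg E.
  by apply: filterS Forb => x /hP[].
have [[B tauB]|unb] := pselect (exists B, F [set x | tau x <= B]).
  have [L hL] : exists L : 'M[C]_m, h x @[x --> F] --> L.
    apply: (@bounded_ultra_cvg_mx _ _ F _ _ h (\sum_(j < m) expR B) FU).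
    apply: filterS2 Forb tauB => x /UbP[Uu hU _ _] xB.
    rewrite (sqn_gram Uu hU); apply: ler_sum => j _; rewrite ler_expR.
    apply: le_trans (ler_norm _) (le_trans _ xB).
    by rewrite /tau (bigD1 j)//= lerDl sumr_ge0.
  exists L.
    apply: (closed_cvg H (algebraic_closed (sa_alg HS)) _ _ hL).
    by apply: filterS Forb => x /hP[].
  have LZ : h x *m Z @[x --> F] --> L *m Z by apply: cvg_mulmx hL _; exact: cvg_cst.
  exact: cvg_mx_unique LZ hZW.
exfalso; apply: (@unbounded_not_least R _ F m n H Z h (fun x => (Ub x).1)
  (fun x => (Ub x).2) (sqn W + 1) FU HS Zmin).
- by apply: filterS Forb => x /UbP[].
- by apply: filterS Forb => x /UbP[].
- by apply: filterS Forb => x /UbP[].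
- by apply: filterS Forb => x /UbP[].
- by apply: filterS Forb => x /hP[].
- have : \forall x \near F, sqn (h x *m Z) < sqn W + 1.
    by apply: (cvgr_lt _ (cvg_sqn hZW)); rewrite ltrDl.
  by apply: filterS => x /ltW.
- move=> B; have [FB|FB] := in_ultra_setVsetC [set x | tau x <= B] FU.
    by case: unb; exists B.
  by apply: filterS FB => x /negP; rewrite -ltNge.
Qed.

Lemma closed_orbit_min m n (H : set 'M[C]_m) (Y : 'M[C]_(m, n)) : H 1%:M ->
  closed (Defs.orbit H Y) ->
  exists2 h, H h & forall g, H g -> sqn (h *m Y) <= sqn (g *m Y).
Proof.
move=> H1 cH; have [|_ [h Hh <-] hmin] := closed_min_sqn cH.
  by exists Y, 1%:M; rewrite ?mul1mx.
by exists h => // g Hg; apply: hmin; exists g.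
Qed.

End KempfNessTheorem.

(** * Algebraic groups of unitary matrices *)

Section BoundedAlgebraicGroups.
Context {R : realType}.
Local Notation C := (Cx R).

Lemma nsqD_le (x y : C) : nsq (x + y) <= 2 * nsq x + 2 * nsq y.
Proof.
rewrite !nsqE reCD imCD.
have := sqr_ge0 (reC x - reC y); have := sqr_ge0 (imC x - imC y).
by rewrite !expr2; lra.
Qed.

Lemma sqnD_le p q (X Y : 'M[C]_(p, q)) : sqn (X + Y) <= 2 * sqn X + 2 * sqn Y.
Proof.
rewrite /sqn !mulr_sumr -big_split; apply: ler_sum => i _.
rewrite !mulr_sumr -big_split; apply: ler_sum => j _.
by rewrite mxE nsqD_le.
Qed.

Lemma sqnN p q (X : 'M[C]_(p, q)) : sqn (- X) = sqn X.
Proof.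
do 2![apply: eq_bigr => ? _]; apply: toC_inj.
by rewrite !toC_nsq mxE rmorphN mulrNN.
Qed.

(** The ultrafilter refines the filter of sets that miss only finitely many points of [X]. *)
Lemma infinite_ultra (T : Type) (X : set T) : infinite_set X ->
  exists2 F : set_system T, UltraFilter F &
    F X /\ forall x, F [set y | y <> x].
Proof.
move=> iX; pose F0 : set_system T := [set A | finite_set (X `\` A)].
have FF0 : ProperFilter F0.
  split; first by rewrite /F0 /= setD0.
  split=> [|A B fA fB|A B AB].
  - by rewrite /F0 /= setDT.
  - by rewrite /F0 /= setDIr finite_setU.
  - by apply: sub_finite_set => x [Xx nB]; split => // /AB.
have [F [FU F0F]] := ultraFilterLemma FF0; exists F => //; split.
  by apply: F0F; rewrite /F0 /= setDv.
move=> x; apply: F0F; apply: (sub_finite_set _ (finite_set1 x)) => y [_ /contrapT].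
by [].
Qed.

(* An accumulation point of the group is translated to the identity. *)
Lemma infinite_unitary_near1 m (K : set 'M[C]_m) :
    infinite_set K -> (forall g h, K g -> K h -> K (g *m h)) ->
    (forall g, K g -> K (g^t*)) -> (forall g, K g -> g \is unitarymx) ->
  forall e : R, 0 < e -> exists u, [/\ K u, u <> 1%:M & sqn (u - 1%:M) < e].
Proof.
move=> iK KM Kadj Ku e e0; have [F FU [FK Fne]] := infinite_ultra iK.
have [L FL] : exists L : 'M[C]_m, g @[g --> F] --> L.
  apply: (@bounded_ultra_cvg_mx _ _ F _ _ id m%:R FU).
  by apply: filterS FK => g /Ku/sqn_unitary ->.
(* A quarter of [e], since [sqnD_le] doubles both summands. *)
have near_L : \forall g \near F, sqn (g - L) < e / 4.
  have : sqn (g - L) @[g --> F] --> sqn (L - L).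
    by apply: cvg_sqn; apply/cvg_mx => i j; rewrite !mxE; under eq_fun do rewrite !mxE;
      apply: cvgB; [move/cvg_mx : FL; apply|exact: cvg_cst].
  have -> : sqn (L - L) = 0 by apply/eqP; rewrite sqn_eq0 subrr.
  by move=> sL; apply: (cvgr_lt _ sL); lra.
have [g0 [Kg0 g0L]] := filter_ex (filterI FK near_L).
have [g1 [Kg1 [g1L g10]]] := filter_ex (filterI FK (filterI near_L (Fne g0))).
have g0u := Ku _ Kg0; have g0u' : g0^t* \is unitarymx by rewrite trmxC_unitary.
exists (g1 *m g0^t*); split; first by apply: KM => //; exact: Kadj.
  by move=> E; apply: g10; rewrite -(mulmx1 g1) -(unitarymx_adjl g0u) mulmxA E mul1mx.
rewrite -(unitarymxP g0u) -mulmxBl (sqn_unitaryr _ g0u').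
rewrite (_ : g1 - g0 = (g1 - L) + - (g0 - L)); last by rewrite opprB addrA subrK.
by apply: le_lt_trans (sqnD_le _ _) _; rewrite sqnN; lra.
Qed.

Definition cis (x : R) : C := toC (cos x) + iC * toC (sin x).

Lemma cisD x y : cis (x + y) = cis x * cis y.
Proof.
have E (a b c d : C) : (a + iC * b) * (c + iC * d) = a * c + iC * iC * (b * d)
  + iC * (b * c + a * d) by ring.
rewrite /cis E iC_sqr mulN1r sinD cosD; congr (_ + iC * _).
  by rewrite rmorphB !rmorphM.
by rewrite rmorphD !rmorphM.
Qed.

Lemma cis0 : cis 0 = 1.
Proof. by rewrite /cis cos0 sin0 rmorph0 mulr0 addr0 rmorph1. Qed.

Lemma cis_muln x k : cis (x *+ k) = cis x ^+ k.
Proof.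
by elim: k => [|k IH]; rewrite ?mulr0n ?cis0 ?expr0// mulrS cisD IH exprS.
Qed.

Lemma cis_sum (I : Type) (r : seq I) (P : pred I) (x : I -> R) :
  cis (\sum_(i <- r | P i) x i) = \prod_(i <- r | P i) cis (x i).
Proof. exact: (big_morph _ cisD cis0). Qed.

(** Angles below 1 lie in the interval where [sin] is injective, as [1 <= pi / 2]. *)
Lemma cis_inj_small (x y : R) : `|x| < 1 -> `|y| < 1 -> cis x = cis y -> x = y.
Proof.
move=> x1 y1 /(congr1 imC); rewrite !imC_rect.
have pi1 : 1 <= pi / 2 :> R by have := @pi_ge2 R; lra.
have small (z : R) : `|z| < 1 -> z \in `[(- (pi / 2)), pi / 2].
  by rewrite ltr_norml in_itv/= => /andP[? ?]; apply/andP; split; lra.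
by move=> /(congr1 asin); rewrite !sinK ?small.
Qed.

Lemma cis_asin (z : C) : nsq z = 1 -> 0 <= reC z -> z = cis (asin (imC z)).
Proof.
move=> z1 z0; have im1 : -1 <= imC z <= 1.
  by rewrite -ler_norml -sqrtr_sqr -[leRHS]sqrtr1 ler_wsqrtr// -z1 le_Im_nsq.
rewrite [LHS]Cx_rect /cis cos_asin// asinK// -z1 nsqE addrK sqrtr_sqr.
by rewrite ger0_norm.
Qed.

Lemma monomial_cis m (x : 'I_m -> R) mu :
  monomial (fun j => cis (x j)) mu = cis (\sum_j x j *+ mu j).
Proof. by rewrite cis_sum; apply: eq_bigr => j _; rewrite cis_muln. Qed.

End BoundedAlgebraicGroups.

Section FiniteUnitaryGroups.
Context {R : realType}.
Local Notation C := (Cx R).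

Lemma hdiag_iter m (K : set 'M[C]_m) (U : 'M[C]_m) (d : 'I_m -> C) :
    K 1%:M -> (forall g h, K g -> K h -> K (g *m h)) -> U \is unitarymx ->
  K (hdiag U (\row_j d j)) -> forall k, K (hdiag U (\row_j d j ^+ k)).
Proof.
move=> K1 KM Uu Kd; elim=> [|k IH].
  suff -> : hdiag U (\row_j d j ^+ 0) = 1%:M by [].
  by rewrite -(hdiag1 Uu); congr hdiag; apply/rowP => j; rewrite !mxE expr0.
suff -> : hdiag U (\row_j d j ^+ k.+1) =
    hdiag U (\row_j d j) *m hdiag U (\row_j d j ^+ k) by exact: KM.
rewrite (hdiagM _ _ Uu); congr hdiag; apply/rowP => j; by rewrite !mxE exprS.
Qed.

(** The eigenvalues are diagonal entries after conjugation by [U], which preserves the Frobenius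
    norm. *)
Lemma unitary_spectrum m (u U : 'M[C]_m) d j : U \is unitarymx ->
  u \is unitarymx -> u = hdiag U d ->
  nsq (d 0 j) = 1 /\ nsq (d 0 j - 1) <= sqn (u - 1%:M).
Proof.
move=> Uu uu uE; split.
  apply: toC_inj; rewrite toC_nsq rmorph1.
  have /unitarymxP := uu; rewrite uE adj_hdiag (hdiagM _ _ Uu) -(hdiag1 Uu) => E.
  have := hdiag_diag (const_mx 1) j Uu; rewrite -E (hdiag_diag _ _ Uu) !mxE.
  by [].
have -> : d 0 j - 1 = (U *m (u - 1%:M) *m U^t*) j j.
  have := hdiag_diag d j Uu; rewrite -uE => <-.
  by rewrite mulmxBr mulmxBl mulmx1 (unitarymxP Uu) !mxE eqxx.
apply: le_trans (le_entry_sqn _ _ _) _.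
by rewrite sqn_unitaryr ?trmxC_unitary// sqn_unitaryl.
Qed.

(** The factor does not depend on [i]: small angles make all monomial angles of a polynomial
    function small at once. *)
Lemma monomial_bound (I : finType) m (mu : I -> 'I_m -> nat) (x : 'I_m -> R) i :
  `|\sum_j x j *+ mu i j| <= (\sum_k \sum_j (mu k j)%:R) * \sum_j `|x j|.
Proof.
apply: le_trans (ler_norm_sum _ _ _) _.
apply: (@le_trans _ _ (\sum_j (mu i j)%:R * \sum_l `|x l|)).
  apply: ler_sum => j _; rewrite normrMn -[leLHS]mulr_natl ler_wpM2l//.
  by rewrite [leRHS](bigD1 j)//= lerDl sumr_ge0.
rewrite -mulr_suml ler_wpM2r ?sumr_ge0// [leRHS](bigD1 i)//= lerDl.
by do 2![apply: sumr_ge0 => ? _].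
Qed.

(* If the group were infinite, then elements near the identity would have
   eigenvalues [cis th] with small [th], so that a given polynomial function
   vanishing on the group also vanishes at [expR (th / tau)]; in the limit the
   group contains a nontrivial positive definite matrix. *)
Theorem finite_unitary_algebraic m (K : set 'M[C]_m) :
    algebraic K -> K 1%:M -> (forall g h, K g -> K h -> K (g *m h)) ->
    (forall g, K g -> K (g^t*)) -> (forall g, K g -> g \is unitarymx) ->
  finite_set K.
Proof.
move=> aK K1 KM Kadj Ku; apply: contrapT => iK.
(* Punctured neighbourhoods of the identity in [K], nonempty because [K] is infinite. *)
pose B (e : R) := [set u : 'M[C]_m | [/\ K u, u <> 1%:M & sqn (u - 1%:M) < e]].
have FF : ProperFilter (filter_from [set e : R | 0 < e] B).
  apply: filter_from_proper => [|e /= e0]; last exact: infinite_unitary_near1.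
  apply: filter_from_filter => [|e d /= e0 d0]; first by exists 1 => /=.
  exists (Num.min e d) => /=; first by rewrite lt_min e0.
  by move=> u [Hu u1]; rewrite lt_min => /andP[ue ud]; split; split.
have [F [FU FB]] := ultraFilterLemma FF.
have Fe e : 0 < e -> F (B e) by move=> e0; apply: FB; exists e.
have FK : \forall u \near F, K u by apply: filterS (Fe 1 ltr01) => u [].
have /choice[Ud UdP] : forall u, exists Ud : 'M[C]_m * 'rV[C]_m,
    K u -> Ud.1 \is unitarymx /\ u = hdiag Ud.1 Ud.2.
  move=> u; have [Kgu|nKu] := pselect (K u); last by exists (0, 0).
  have [|U [d Ud]] := @normalmx_hdiag _ _ u; last by exists (U, d).
  by apply/normalmxP; rewrite (unitarymxP (Ku _ Kgu)) unitarymx_adjl// Ku.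
pose U u := (Ud u).1; pose d u := (Ud u).2.
have dP u j : K u -> nsq (d u 0 j) = 1 /\ nsq (d u 0 j - 1) <= sqn (u - 1%:M).
  by move=> Kgu; have [Uu uE] := UdP _ Kgu; exact: unitary_spectrum Uu (Ku _ Kgu) uE.
pose th u j := asin (imC (d u 0 j)).
(* Eigenvalues at distance less than 1 from 1 have positive real part, where [asin] recovers the
   angle. *)
have dcis : \forall u \near F, forall j, d u 0 j = cis (th u j).
  apply: filterS (Fe 1 ltr01) => u [Kgu _ u1] j; have [dn dle] := dP _ j Kgu.
  apply: cis_asin => //; have := le_lt_trans (le_trans (le_Re_nsq _) dle) u1.
  by rewrite reCB reC1; nra.
have th0 j : th u j @[u --> F] --> (0 : R).
  have im0 : imC (d u 0 j) @[u --> F] --> (0 : R).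
    apply/cvgrPdist_lt => e e0; have e20 : 0 < e ^+ 2 by rewrite exprn_gt0.
    apply: filterS (Fe _ e20) => u [Kgu _ ue]; have [_ dle] := dP _ j Kgu.
    have := le_lt_trans (le_trans (le_Im_nsq _) dle) ue.
    rewrite imCB imC1 subr0 sub0r normrN => ie.
    by rewrite -(ltr_pXn2r (n := 2)) ?nnegrE ?normr_ge0 ?ltW// real_normK// num_real.
  have asin0 : asin 0 = 0 :> R.
    rewrite -[X in asin X]sin0 sinK// in_itv/=.
    by have := @pi_ge0 R; move=> ?; apply/andP; split; lra.
  rewrite -asin0; apply: (cvg_comp _ _ im0); apply: continuous_asin.
  by rewrite ltrN10 ltr01.
pose tau u := \sum_j `|th u j|.
have tau_cvg0 : tau u @[u --> F] --> (0 : R).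
  have -> : 0 = \sum_(j < m) `|0 : R| by rewrite big1// => j _; rewrite normr0.
  apply: (@cvg_bigsum R _ F _ _ _ (fun j u => `|th u j|) (fun=> `|0 : R|)) => j.
  exact: cvg_norm (th0 j).
have tau0 : \forall u \near F, 0 < tau u.
  apply: filterS2 dcis (Fe 1 ltr01) => u dc [Kgu u1 _].
  rewrite lt_def sumr_ge0 ?andbT//; apply/negP => /eqP/psumr_eq0P t0; apply: u1.
  have [Uu ->] := UdP _ Kgu; rewrite -(hdiag1 Uu); congr hdiag; apply/rowP => j.
  by rewrite -/(d u) dc mxE (normr0_eq0 (t0 _ j isT)) ?cis0// => ? _.
have [V UV] : exists V : 'M[C]_m, U u @[u --> F] --> V.
  apply: (@bounded_ultra_cvg_mx _ _ F _ _ U m%:R FU).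
  by apply: filterS FK => u /UdP[/sqn_unitary -> _].
have Vu : V \is unitarymx.
  by apply: cvg_unitary UV _; apply: filterS FK => u /UdP[].
have /choice[a ta] : forall j, exists l : R, th u j / tau u @[u --> F] --> l.
  move=> j; apply: (@bounded_ultra_cvg _ _ F _ 1 FU).
  apply: filterS tau0 => t t0; rewrite normrM normfV (gtr0_norm t0) ler_pdivrMr//.
  by rewrite mul1r /tau (bigD1 j)//= lerDl sumr_ge0.
have a1 : \sum_j `|a j| = 1.
  apply: (cvg_eq_near (F := F) (u := fun t => \sum_j `|th t j / tau t|)).
    apply: (@cvg_bigsum R _ F _ _ _ (fun j t => `|th t j / tau t|)
      (fun j => `|a j|)) => j.
    exact: cvg_norm (ta j).
  apply: filterS tau0 => t t0.
  under eq_bigr do rewrite normrM normfV (gtr0_norm t0).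
  by rewrite -mulr_suml divff// gt_eqF.
have KV : K (hexp V a).
  apply: (algebraic_cvg (F := F) (u := fun u => hexp (U u) (fun j => th u j / tau u)) aK).
    exact: (cvg_hexp UV ta).
  move=> f pf fK; have [I [mu fE]] := polyfun_diag pf.
  pose D : R := \sum_i \sum_j (mu i j)%:R.
  (* This makes [lam i] recoverable from [cis (lam i)]; the neighbourhood depends on [f] through
     [D]. *)
  have small : \forall u \near F, D * tau u < 1.
    apply: (cvgr_lt (D * 0)); last by rewrite mulr0 ltr01.
    by apply: cvgM tau_cvg0; exact: cvg_cst.
  apply: filterS3 FK dcis small => u Kgu dc tsmall.
  have [c cE] := fE ((U u)^t*) (U u); have [Uu uE] := UdP _ Kgu.
  pose lam i := \sum_j th u j *+ mu i j.
  have lam1 i : `|lam i| < 1 by exact: le_lt_trans (monomial_bound _ _ _) tsmall.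
  rewrite /hexp /hdiag cE.
  (* The power sums are the values of [f] at the powers of [u], and [expR (lam i / tau u)] is a
     function of [cis (lam i)]. *)
  apply: (power_sums_eq0 (x := fun i => cis (lam i))) => [k|i i'].
    transitivity (f (hdiag (U u) (\row_j (cis (th u j)) ^+ k))).
      by rewrite /hdiag cE; apply: eq_bigr => i _; rewrite monomialX monomial_cis.
    apply: fK; apply: hdiag_iter => //.
    suff -> : \row_j cis (th u j) = d u by rewrite -uE.
    by apply/rowP => j; rewrite mxE dc.
  move=> /(cis_inj_small (lam1 i) (lam1 i')) E; rewrite !monomial_exp.
  have muE l : \sum_j (mu l j)%:R * (th u j / tau u) = lam l / tau u.
    by rewrite mulr_suml; apply: eq_bigr => j _; rewrite mulrA mulr_natl.
  by rewrite !muE E.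
(* A matrix that is both unitary and Hermitian squares to the identity, so [a j + a j = 0], against
   [a1]. *)
have a0 j : a j = 0.
  have /unitarymxP := Ku _ KV; rewrite adj_hexp (hexpD _ _ Vu).
  rewrite -(hexp0 Vu (fun=> erefl)) => /(hexp_inj Vu)/(_ j); lra.
by move/eqP: a1; rewrite big1 => [|j _]; rewrite ?a0 ?normr0// eq_sym oner_eq0.
Qed.

End FiniteUnitaryGroups.

(** * Likelihood *)

Section Likelihood.

Lemma sample_cov_gram (C : numClosedFieldType) m n (Y : 'M[C]_(m, n)) :
  \sum_(i < n) col i Y *m (col i Y)^t* = Y *m Y^t*.
Proof.
apply/matrixP => i j; rewrite summxE mxE; apply: eq_bigr => k _.
by rewrite mxE big_ord1 !mxE.
Qed.

Lemma tr_gram_mul (C : numClosedFieldType) m n (g : 'M[C]_m) (Y : 'M[C]_(m, n)) :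
  \tr (g^t* *m g *m (Y *m Y^t*)) = trn (g *m Y).
Proof. by rewrite /trn adjM mxtrace_mulC !mulmxA mxtrace_mulC !mulmxA. Qed.

Context {R : realType} {m n : nat}.
Local Notation C := (Cx R).
Implicit Types (G : set 'M[C]_m) (Y : 'M[C]_(m, n)).

Transparent Cx toC reC.

Lemma gaussian_modelE G :
  @gaussian_model R m G = [set (g^t* *m g : 'M[C]_m) | g in G].
Proof. by []. Qed.

Lemma loglik_abstract Y (Psi : 'M[C]_m) : @loglik R m n Y Psi =
  ln (reC (\det Psi)) -
  reC (\tr (Psi *m (n%:R^-1 *: \sum_(i < n) col i Y *m (col i Y)^t*))).
Proof. by []. Qed.

Lemma reC_toC (x : R) : reC (toC x) = x.
Proof. by []. Qed.

Opaque Cx toC reC.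

(** Dividing [g] by an [m]-th root [c] of its determinant gives [h], and [t] is the squared modulus
    of [c]. Conversely [h] is scaled by the square root of [t]. *)
Lemma gaussian_model_scaling G (Psi : 'M[C]_m) :
    (0 < m)%N -> GL_subgroup G -> scaling_closed G ->
  @gaussian_model R m G Psi <->
  exists t h, [/\ 0 < t, SL_part G h & Psi = toC t *: (h^t* *m h)].
Proof.
move=> m0 [Gunit _ _ _] Gscal; rewrite gaussian_modelE; split; last first.
  move=> [t [h [t0 [Gh _] ->]]]; exists (toC (Num.sqrt t) *: h).
    by apply: Gscal => //; rewrite fmorph_eq0 sqrtr_eq0 -ltNge.
  rewrite adjZ conj_toC -scalemxAl -scalemxAr scalerA -rmorphM -expr2.
  by rewrite sqr_sqrtr ?ltW.
move=> [g Gg <-]; have g0 : \det g != 0 by rewrite -unitfE -unitmxE; exact: Gunit.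
have [c cm] : exists c : C, c ^+ m = \det g by exists (m.-root (\det g)); rewrite rootCK.
have c0 : c != 0 by apply: contraNneq g0 => c0; rewrite -cm c0 expr0n gtn_eqF.
exists (nsq c), (c^-1 *: g); split.
- by rewrite lt_def nsq_eq0 c0 nsq_ge0.
- by split; [apply: Gscal; rewrite ?invr_eq0|rewrite detZ exprVn cm mulVf].
- rewrite adjZ -scalemxAl -scalemxAr !scalerA toC_nsq.
  rewrite [X in X *: _](_ : _ = 1) ?scale1r// fmorphV.
  have cc0 : Num.conj c != 0 by rewrite conjC_eq0.
  by field; rewrite c0.
Qed.

(** The log-likelihood at [t] times the Gram matrix of [h], where [s] is the squared norm of
    [h *m Y]. *)
Definition profile (t s : R) : R := m%:R * ln t - t * s / n%:R.

Lemma loglik_scaling Y t h : 0 < t -> \det h = 1 ->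
  @loglik R m n Y (toC t *: (h^t* *m h)) = profile t (sqn (h *m Y)).
Proof.
move=> t0 h1; rewrite loglik_abstract sample_cov_gram /profile; congr (_ - _).
  rewrite detZ det_gram h1 mulr1 rmorph1 mulr1 -rmorphXn reC_toC lnXn//.
  by rewrite mulr_natl.
rewrite -scalemxAr -scalemxAl !linearZ /= tr_gram_mul -sqnE.
have -> : n%:R^-1 * (toC t * toC (sqn (h *m Y))) = toC (t * sqn (h *m Y) / n%:R).
  by rewrite mulrC -rmorphM [RHS]rmorphM fmorphV rmorph_nat.
exact: reC_toC.
Qed.

End Likelihood.

(** * Maximizing over the scaling factor *)

Section Profile.
Context {R : realType} {m n : nat}.
Hypotheses (m_gt0 : (0 < m)%N) (n_gt0 : (0 < n)%N).
Implicit Types (t s : R).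
Local Notation profile := (@profile R m n).

Let M0 : 0 < m%:R :> R. Proof. by rewrite ltr0n. Qed.
Let N0 : 0 < n%:R :> R. Proof. by rewrite ltr0n. Qed.

(** The zero in [t] of the derivative [m / t - s / n]. *)
Definition argmax_profile s : R := m%:R * n%:R / s.

Lemma argmax_profile_gt0 s : 0 < s -> 0 < argmax_profile s.
Proof. by move=> s0; rewrite !(divr_gt0, mulr_gt0). Qed.

(** In terms of [y = t / argmax_profile s] the claim becomes [1 + ln y < y] for [y != 1]. *)
Lemma profile_max_lt t s : 0 < t -> 0 < s -> t != argmax_profile s ->
  profile t s < profile (argmax_profile s) s.
Proof.
move=> t0 s0 ts; pose y := t / argmax_profile s.
have a0 := argmax_profile_gt0 s0; have y0 : 0 < y by rewrite divr_gt0.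
have lny : ln y != 0.
  rewrite ln_eq0//; apply: contra ts => /eqP y1.
  by apply/eqP; rewrite -[LHS](divfK (lt0r_neq0 a0)) -/y y1 mul1r.
have := expR_gt1Dx lny; rewrite lnK ?posrE// => lty.
have lnt : ln t = ln y + ln (argmax_profile s).
  by rewrite -lnM ?posrE// /y divfK// gt_eqF.
have tE : t * s / n%:R = m%:R * y.
  by rewrite /y /argmax_profile; field; rewrite !gt_eqF.
have aE : argmax_profile s * s / n%:R = m%:R.
  by rewrite /argmax_profile; field; rewrite !gt_eqF.
rewrite /profile tE aE lnt.
suff : m%:R * (1 + ln y) < m%:R * y by lra.
by rewrite ltr_pM2l.
Qed.

Lemma profile_max t s : 0 < t -> 0 < s ->
  profile t s <= profile (argmax_profile s) s.
Proof.
move=> t0 s0; have [->//|ts] := eqVneq t (argmax_profile s).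
by apply/ltW/profile_max_lt.
Qed.

Lemma profile_le t s s' : 0 < t -> s' <= s -> profile t s <= profile t s'.
Proof.
by move=> t0 ss; rewrite lerB// ler_pM2r ?invr_gt0// ler_pM2l.
Qed.

Lemma profile_lt t s s' : 0 < t -> s' < s -> profile t s < profile t s'.
Proof.
by move=> t0 ss; rewrite ltrD2l ltrN2 ltr_pM2r ?invr_gt0// ltr_pM2l.
Qed.

(** Excludes maximizers with [h *m Y = 0]: doubling [t] then increases the likelihood. *)
Lemma profile0_lt t : 0 < t -> profile t 0 < profile (2 * t) 0.
Proof.
move=> t0; rewrite /profile !mulr0 !mul0r !subr0 ltr_pM2l// ltr_ln ?posrE//; lra.
Qed.

Lemma profile_unbounded (B : R) : exists2 e, 0 < e &
  exists2 t, 0 < t & forall s, 0 <= s -> s < e -> B < profile t s.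
Proof.
(* With [t = expR x] and [s < expR (- x)] the linear term is below 1, so the profile exceeds
   [x - 1], which is greater than [B]. *)
pose x : R := `|B| + 2; exists (expR (- x)); first exact: expR_gt0.
exists (expR x) => [|s s0 se]; first exact: expR_gt0.
rewrite /profile expRK.
have s1 : expR x * s < 1.
  by move: se; rewrite expRN -ltr_pdivlMl ?expR_gt0// mulr1.
have sn : expR x * s / n%:R < 1.
  rewrite ltr_pdivrMr// mul1r (lt_le_trans s1)// ler1n//.
have mx : x <= m%:R * x.
  rewrite ler_peMl ?ler1n// /x; have := normr_ge0 B; lra.
have := ler_norm B; rewrite -/x in mx *; move: mx; rewrite /x; lra.
Qed.

End Profile.

(** * Orbits and stabilizers under a change of base point *)

Section Conjugation.
Context {R : realType} {m n : nat}.
Local Notation C := (Cx R).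
Variable (H : set 'M[C]_m).
Hypothesis HS : selfadjoint_SL H.

Lemma sa_unit g : H g -> g \in unitmx.
Proof. by move=> /(sa_det HS) g1; rewrite unitmxE g1 unitr1. Qed.

Lemma orbit_shift (Y : 'M[C]_(m, n)) h : H h ->
  Defs.orbit H (h *m Y) = Defs.orbit H Y.
Proof.
move=> Hh; apply/seteqP; split => _ [g Hg <-].
  by exists (g *m h); [exact: saM|rewrite mulmxA].
exists (g *m invmx h); first by apply: saM => //; exact: saV.
by rewrite -mulmxA mulKmx ?sa_unit.
Qed.

(** The two stabilizers are conjugate by [h]. *)
Lemma finite_stabilizer_shift (Y : 'M[C]_(m, n)) h : H h ->
  finite_set (stabilizer H Y) -> finite_set (stabilizer H (h *m Y)).
Proof.
move=> Hh fY; have hu := sa_unit Hh.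
apply: sub_finite_set (finite_image (fun s => h *m s *m invmx h) fY).
move=> s [Hs sY]; exists (invmx h *m s *m h); last first.
  by rewrite !mulmxA mulmxV// mul1mx mulmxK.
split; first by apply: saM => //; apply: saM => //; exact: saV.
by rewrite -!mulmxA sY mulKmx.
Qed.

(** A nonzero [b j] would make the natural powers pairwise distinct. *)
Lemma finite_real_powers (X : set 'M[C]_m) (U : 'M[C]_m) (b : 'I_m -> R) :
    U \is unitarymx -> finite_set X ->
    (forall t, X (hexp U (fun j => t * b j))) ->
  forall j, b j = 0.
Proof.
move=> Uu fX Xb j; apply: contrapT => /eqP bj.
pose f (k : nat) := hexp U (fun j => k%:R * b j).
have f_inj : injective f.
  move=> k l /(hexp_inj Uu)/(_ j)/(mulIf bj)/eqP; rewrite eqr_nat => /eqP.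
  by [].
apply: infinite_nat; rewrite -(@preimage_range _ _ f).
apply: finite_preimage; first by move=> k l _ _ /f_inj.
by apply: sub_finite_set fX => _ [k _ <-]; exact: Xb.
Qed.

End Conjugation.

Lemma selfadjoint_SL_part {R : realType} m (G : set 'M[Cx R]_m) :
  GL_subgroup G -> Zariski_closed G -> self_adjoint G ->
  selfadjoint_SL (SL_part G).
Proof.
move=> [Gunit G1 GM GV] Gcl Gadj; split.
- exact: algebraic_SL_part.
- by move=> g [].
- by split=> //; rewrite det1.
- by move=> g h [Gg g1] [Gh h1]; split; [exact: GM|rewrite det_mulmx g1 h1 mulr1].
- by move=> g [Gg g1]; split; [exact: GV|rewrite det_inv g1 invr1].
- by move=> g [Gg g1]; split; [exact: Gadj|rewrite det_map_mx det_tr g1 rmorph1].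
Qed.

(** * From norms on the orbit to maximum likelihood *)

Section Main.
Context {R : realType} {m n : nat}.
Local Notation C := (Cx R).
Variables (G : set 'M[C]_m) (Y : 'M[C]_(m, n)).
Hypotheses (m_gt0 : (0 < m)%N) (n_gt0 : (0 < n)%N).
Hypotheses (G_subgroup : GL_subgroup G) (G_closed : Zariski_closed G)
  (G_selfadj : self_adjoint G) (G_scal : scaling_closed G).

Local Notation H := (SL_part G).
Local Notation gram h := (h^t* *m h).
Local Notation profile := (@profile R m n).
Local Notation argmax_profile := (@argmax_profile R m n).

Let HS : selfadjoint_SL H := selfadjoint_SL_part G_subgroup G_closed G_selfadj.

Let model Psi := gaussian_model_scaling Psi m_gt0 G_subgroup G_scal.

Lemma model_scaling t h : 0 < t -> H h -> @gaussian_model R m G (toC t *: gram h).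
Proof. by move=> t0 Hh; apply/model; exists t, h. Qed.

(** For the converse, the closure of the orbit has a point of least norm, which must be 0. *)
Lemma unstable_sqn : unstable H Y <->
  forall e : R, 0 < e -> exists2 h, H h & sqn (h *m Y) < e.
Proof.
split=> [/closure_ultra[F FU [F0 Forb]] e e0|small].
  have s0 : \forall x \near F, sqn x < e.
    apply: (cvgr_lt _ (cvg_sqn (u := id) F0)).
    by have /eqP -> : sqn (0 : 'M[C]_(m, n)) == 0 by rewrite sqn_eq0.
  by have [_ [[h Hh <-] he]] := filter_ex (filterI Forb s0); exists h.
have [||x Ox xmin] := @closed_min_sqn _ _ _ (closure (Defs.orbit H Y)).
- exact: closed_closure.
- by exists (1%:M *m Y); apply: subset_closure; exists 1%:M => //; exact: sa1 HS.
suff x0 : x = 0 by move: Ox; rewrite x0.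
apply/eqP; rewrite -sqn_eq0 eq_le sqn_ge0 andbT.
apply/ler_addgt0Pl => e /small[h Hh he]; rewrite addr0.
by apply: le_trans (ltW he); apply: xmin; apply: subset_closure; exists h.
Qed.

Lemma unstable_unbounded : unstable H Y <-> ~ @loglik_bounded_above R m n G Y.
Proof.
rewrite unstable_sqn; split=> [small [B Bub]|unb e e0].
  have [e e0 [t t0 tB]] := profile_unbounded m_gt0 n_gt0 B.
  have [h Hh he] := small e e0.
  have /Bub : [set @loglik R m n Y Psi | Psi in @gaussian_model R m G]
      (profile t (sqn (h *m Y))).
    exists (toC t *: gram h); first exact: model_scaling.
    by rewrite (loglik_scaling _ t0 (sa_det HS Hh)).
  by rewrite leNgt tB// sqn_ge0.
(* If the squared norm is at least [e] on the whole orbit, the maximum of the profile at [e] bounds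
   the log-likelihood. *)
apply: contrapT => nosmall; apply: unb; exists (profile (argmax_profile e) e).
move=> _ [Psi /model[t [h [t0 Hh ->]]] <-].
rewrite (loglik_scaling _ t0 (sa_det HS Hh)).
apply: le_trans (profile_max m_gt0 n_gt0 t0 e0); apply: profile_le => //.
by rewrite leNgt; apply/negP => he; apply: nosmall; exists h.
Qed.

(** As [h] is invertible, the positivity condition expresses [Y != 0]. *)
Definition norm_minimizer h :=
  [/\ H h, 0 < sqn (h *m Y) & minimal H (h *m Y)].

Lemma minimizer_le h0 h : norm_minimizer h0 -> H h ->
  sqn (h0 *m Y) <= sqn (h *m Y).
Proof.
move=> [Hh0 _ hmin] Hh.
have : H (h *m invmx h0) by apply: (saM HS) => //; exact: (saV HS).
by move=> /hmin; rewrite mulmxA mulmxKV// (sa_unit HS).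
Qed.

(** A closed orbit attains its least norm; conversely the orbit of [Y] is that of the minimal vector
    [h *m Y], which is closed. *)
Lemma polystable_minimizer : polystable H Y <-> exists h, norm_minimizer h.
Proof.
split=> [[Y0 cY]|[h [Hh hY0 hmin]]].
  have [h Hh hmin] := closed_orbit_min (sa1 HS) cY.
  exists h; split => //.
    rewrite sqn_gt0; apply/eqP => hY; apply: Y0.
    by rewrite -(mulKmx (sa_unit HS Hh) Y) hY mulmx0.
  by move=> g Hg; rewrite mulmxA; apply: hmin; exact: (saM HS).
split; last by rewrite -(orbit_shift HS Y Hh); exact: closed_orbit_minimal.
move=> Y0; move: hY0; rewrite Y0 mulmx0 sqn_gt0 eqxx.
by [].
Qed.

(** The profile strictly decreases in [s] and has a unique maximizer in [t], so a maximum forces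
    both the least norm and this [t]. *)
Lemma MLE_scaling h0 (Psi : 'M[C]_m) : norm_minimizer h0 ->
  @MLE R m n G Y Psi <-> exists h, [/\ H h, sqn (h *m Y) = sqn (h0 *m Y) &
    Psi = toC (argmax_profile (sqn (h0 *m Y))) *: gram h].
Proof.
move=> h0min; have [Hh0 s0 _] := h0min; set s := sqn (h0 *m Y) in s0 *.
have a0 := argmax_profile_gt0 m_gt0 n_gt0 s0.
split=> [[/model[t [h [t0 Hh ->]]] Psimax]|[h [Hh hs ->]]].
  have sh : s <= sqn (h *m Y) by exact: minimizer_le.
  have := Psimax _ (model_scaling a0 Hh0).
  rewrite (loglik_scaling _ t0 (sa_det HS Hh)) (loglik_scaling _ a0 (sa_det HS Hh0)).
  rewrite -/s => le_st; have [tE|tn] := eqVneq t (argmax_profile s); last first.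
    have := profile_max_lt m_gt0 n_gt0 t0 s0 tn.
    by rewrite ltNge (le_trans le_st)// profile_le.
  exists h; split => //; last by rewrite tE.
  apply/eqP; rewrite eq_le sh andbT leNgt; apply/negP => /(profile_lt (m := m) n_gt0 t0).
  by rewrite ltNge {1}tE le_st.
split; first exact: model_scaling.
move=> _ /model[t [g [t0 Hg ->]]].
rewrite (loglik_scaling _ t0 (sa_det HS Hg)) (loglik_scaling _ a0 (sa_det HS Hh)) hs.
apply: le_trans (profile_max m_gt0 n_gt0 t0 s0); apply: profile_le => //.
exact: minimizer_le.
Qed.

Lemma MLE_minimizer : @MLE R m n G Y !=set0 <-> exists h, norm_minimizer h.
Proof.
split=> [[_ [/model[t [h [t0 Hh ->]]] Psimax]]|[h0 h0min]]; last first.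
  exists (toC (argmax_profile (sqn (h0 *m Y))) *: gram h0).
  by apply/(MLE_scaling _ h0min); exists h0; split => //; case: h0min.
exists h; split => //.
  rewrite lt_def sqn_ge0 andbT; apply/negP => /eqP hY.
  have t20 : 0 < 2 * t by rewrite mulr_gt0.
  have := Psimax _ (model_scaling t20 Hh).
  rewrite (loglik_scaling _ t0 (sa_det HS Hh)) (loglik_scaling _ t20 (sa_det HS Hh)) hY.
  by rewrite leNgt profile0_lt.
move=> g Hg; have Hgh : H (g *m h) by exact: (saM HS).
have := Psimax _ (model_scaling t0 Hgh).
rewrite (loglik_scaling _ t0 (sa_det HS Hh)) (loglik_scaling _ t0 (sa_det HS Hgh)).
rewrite -mulmxA leNgt => /negP le_h; rewrite leNgt; apply/negP => gh.
by apply: le_h; exact: profile_lt.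
Qed.

Lemma polystable_MLE : polystable H Y <-> @MLE R m n G Y !=set0.
Proof. by rewrite polystable_minimizer MLE_minimizer. Qed.

(** Two norm minimizers differ by some [k] for which the real powers of [k^t* *m k] fix the minimal
    vector. A finite stabilizer makes these powers trivial, so [k] is unitary and the Gram matrices
    agree. *)
Lemma stable_unique_MLE : stable H Y -> exists! Psi, @MLE R m n G Y Psi.
Proof.
move=> [/polystable_minimizer[h0 h0min] fS]; have [Hh0 _ Zmin] := h0min.
exists (toC (argmax_profile (sqn (h0 *m Y))) *: gram h0); split.
  by apply/(MLE_scaling _ h0min); exists h0.
move=> _ /(MLE_scaling _ h0min)[h [Hh hs ->]]; congr (_ *: _).
pose k := h *m invmx h0; have Hk : H k by apply: (saM HS) => //; exact: (saV HS).
have hE : h = k *m h0 by rewrite /k mulmxKV// (sa_unit HS).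
have [U [b [Uu kU _ Hb]]] := selfadjoint_gram HS Hk.
have kZ : sqn (k *m (h0 *m Y)) = sqn (h0 *m Y) by rewrite mulmxA -hE.
have fix_Z := minimal_gram_fix Zmin Uu Hb kU kZ.
have b0 := finite_real_powers Uu (finite_stabilizer_shift HS Hh0 fS)
  (fun t => conj (Hb t) (fix_Z t)).
rewrite hE adjM -mulmxA (mulmxA _ k) kU (hexp0 Uu b0) mul1mx.
by [].
Qed.

(** Each [g] in the stabilizer of the minimal vector [Z] yields an MLE from which [gram g] is
    recovered. Finitely many Gram matrices leave no room for a one-parameter group, so the
    stabilizer is unitary, hence finite. *)
Lemma finite_MLE_stable : @MLE R m n G Y !=set0 -> finite_set (@MLE R m n G Y) ->
  stable H Y.
Proof.
move=> MLE0 fMLE; split; first exact/polystable_MLE.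
have [h0 h0min] := MLE_minimizer.1 MLE0; have [Hh0 s0 Zmin] := h0min.
have h0u := sa_unit HS Hh0.
set Z := h0 *m Y in s0 Zmin.
suff fZ : finite_set (stabilizer H Z).
  rewrite -(mulKmx h0u Y); apply: finite_stabilizer_shift fZ => //.
  exact: (saV HS).
set a := argmax_profile (sqn Z).
have a0 : toC a != 0.
  by rewrite fmorph_eq0 gt_eqF// argmax_profile_gt0.
(* Inverts the passage from [gram g] to the MLE built from [g *m h0]. *)
pose back (Psi : 'M[C]_m) := (invmx h0)^t* *m ((toC a)^-1 *: Psi) *m invmx h0.
have gram_back g : stabilizer H Z g -> [set back Psi | Psi in @MLE R m n G Y] (gram g).
  move=> [Hg gZ]; exists (toC a *: gram (g *m h0)).
    apply/(MLE_scaling _ h0min); exists (g *m h0); split => //; first exact: (saM HS).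
    by rewrite -mulmxA gZ.
  rewrite /back scalerA mulVf// scale1r.
  by rewrite mulmxA -adjM (mulmxK h0u) -mulmxA (mulmxK h0u).
have unitary_stab g : stabilizer H Z g -> g \is unitarymx.
  move=> [Hg gZ]; have [U [b [Uu gU _ Hb]]] := selfadjoint_gram HS Hg.
  have fix_Z := minimal_gram_fix Zmin Uu Hb gU (congr1 (@sqn _ _ _) gZ).
  have b0 : forall j, b j = 0.
    (* The Gram matrix of the element at [t / 2] is the element at [t]. *)
    apply: (finite_real_powers Uu (finite_image back fMLE)) => t.
    have := gram_back _ (conj (Hb (t / 2)) (fix_Z (t / 2))).
    rewrite adj_hexp (hexpD _ _ Uu).
    suff -> : (fun j => t / 2 * b j + t / 2 * b j) = fun j => t * b j by [].
    by apply: funext => j; lra.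
  by apply/unitarymxP/mulmx1C; rewrite gU (hexp0 Uu b0).
apply: finite_unitary_algebraic => //.
- by apply: algebraic_stabilizer; exact: (sa_alg HS).
- by split; [exact: sa1 HS|rewrite mul1mx].
- move=> g h [Hg gZ] [Hh hZ]; split; first exact: (saM HS).
  by rewrite -mulmxA hZ.
(* The adjoint of a unitary [g] is its inverse, so it fixes [Z] too. *)
- move=> g Sg; have [Hg gZ] := Sg; split; first exact: (sa_adj HS).
  by rewrite -[in LHS]gZ mulmxA unitarymx_adjl ?mul1mx// unitary_stab.
Qed.

End Main.

Lemma stability_MLE {R : realType} m n (m_gt0 : (0 < m)%N) (n_gt0 : (0 < n)%N)
    (Y : 'M[Cx R]_(m, n)) (G : set 'M[Cx R]_m) :
    GL_subgroup G -> Zariski_closed G -> self_adjoint G -> scaling_closed G ->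
  [/\ (unstable (SL_part G) Y <-> ~ @loglik_bounded_above R m n G Y),
      (semistable (SL_part G) Y <-> @loglik_bounded_above R m n G Y),
      (polystable (SL_part G) Y <-> @MLE R m n G Y !=set0) &
      (stable (SL_part G) Y <->
        @MLE R m n G Y !=set0 /\ finite_set (@MLE R m n G Y)) /\
      (stable (SL_part G) Y <-> exists! Psi, @MLE R m n G Y Psi)].
Proof.
move=> Gsub Gcl Gadj Gscal.
have unst := unstable_unbounded Y m_gt0 n_gt0 Gsub Gcl Gadj Gscal.
have poly := polystable_MLE Y m_gt0 n_gt0 Gsub Gcl Gadj Gscal.
(* The equivalences for stability are closed in a cycle: stable, unique, nonempty and finite,
   stable. *)
have uniq : stable (SL_part G) Y -> exists! Psi, @MLE R m n G Y Psi.
  exact: stable_unique_MLE.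
have fin : @MLE R m n G Y !=set0 /\ finite_set (@MLE R m n G Y) ->
    stable (SL_part G) Y.
  by move=> [? ?]; exact: finite_MLE_stable.
have uniq_fin : (exists! Psi, @MLE R m n G Y Psi) ->
    @MLE R m n G Y !=set0 /\ finite_set (@MLE R m n G Y).
  move=> [Psi [MPsi PsiU]]; split; first by exists Psi.
  by apply: (sub_finite_set _ (finite_set1 Psi)) => Phi /PsiU ->.
split=> //; last by split; split => [/uniq|]; auto.
rewrite (_ : semistable _ _ = ~ unstable (SL_part G) Y)// unst.
by split=> [/contrapT|? ?].
Qed.

Unset Implicit Arguments.
Set Strict Implicit.
Set Printing Implicit Defensive.

Theorem theorem3p15 (R : realType) (m n : nat) (m_gt0 : (0 < m)%N)
    (n_gt0 : (0 < n)%N) (Y : 'M[R[i]]_(m, n)) (G : set 'M[R[i]]_m)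
    (G_subgroup : GL_subgroup G) (G_closed : Zariski_closed G)
    (G_selfadj : self_adjoint G) (G_scal : scaling_closed G) :
  [/\ (unstable (SL_part G) Y <-> ~ loglik_bounded_above G Y),
      (semistable (SL_part G) Y <-> loglik_bounded_above G Y),
      (polystable (SL_part G) Y <-> MLE G Y !=set0) &
      (stable (SL_part G) Y <-> MLE G Y !=set0 /\ finite_set (MLE G Y)) /\
      (stable (SL_part G) Y <-> exists! Psi, MLE G Y Psi)].
Proof. exact: (@stability_MLE R). Qed.
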